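(* Let $x$ be a real. Every $\Pi^1_1(x)$ inextendible linearly ordered tower contains (as a subset) a $\Pi^1_1(x)$ maximal tower.
   Context: For $x,y\in[\omega]^\omega$, $y\subseteq^* x$ means $y\setminus x$ is finite. An inextendible linearly ordered tower (ilt) is a set $X\subseteq[\omega]^\omega$ linearly ordered by $\subseteq^*$ with no pseudointersection (no infinite $z\subseteq\omega$ with $z\subseteq^* x$ for all $x\in X$). A tower is a set $X\subseteq[\omega]^\omega$ well ordered by $x\le y$ iff $y\subseteq^* x$; it is maximal if it has no pseudointersection. *)

(* Defs.v *)
From mathcomp Require Import all_boot.
From mathcomp Require Import boolp classical_sets cardinality.

Set Implicit Arguments.
Unset Strict Implicit.
Unset Printing Implicit Defensive.

Local Open Scope classical_set_scope.

(* Arithmetical formulas of second-order arithmetic: the language of ordered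
   semirings with membership in set variables and no set quantifier.  Number and
   set variables are numbered separately; number variables are de Bruijn
   indices, bound by AForall. *)
Inductive aterm : Type :=
| AVar of nat
| AZero
| AOne
| AAdd of aterm & aterm
| AMul of aterm & aterm.

Inductive aformula : Type :=
| AEq of aterm & aterm
| ALt of aterm & aterm
| AMem of aterm & nat
| ANot of aformula
| AAnd of aformula & aformula
| AForall of aformula.

Fixpoint aeval (e : seq nat) (t : aterm) : nat :=
  match t with
  | AVar i => nth 0 e i
  | AZero => 0
  | AOne => 1
  | AAdd t1 t2 => aeval e t1 + aeval e t2
  | AMul t1 t2 => aeval e t1 * aeval e t2
  end.

(* Truth in the standard model.  Variables beyond the end of the lists denote
   0 and the empty set. *)
Fixpoint asat (e : seq nat) (E : seq (set nat)) (f : aformula) : Prop :=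
  match f with
  | AEq t1 t2 => aeval e t1 = aeval e t2
  | ALt t1 t2 => aeval e t1 < aeval e t2
  | AMem t i => nth set0 E i (aeval e t)
  | ANot g => ~ asat e E g
  | AAnd g h => asat e E g /\ asat e E h
  | AForall g => forall n : nat, asat (n :: e) E g
  end.

(* Lightface Pi^1_1 relative to x: a single universal real
   quantifier in front of an arithmetical formula, the only parameter being x. *)
Definition Pi11 (x : set nat) (A : set (set nat)) : Prop :=
  exists f : aformula,
    forall y : set nat, A y <-> forall z : set nat, asat [::] [:: z; y; x] f.

Definition inf_reals : set (set nat) := [set y | infinite_set y].

Definition almost_subset (y x : set nat) : Prop := finite_set (y `\` x).

Definition linear_order_on (T : Type) (A : set T) (R : T -> T -> Prop) : Prop :=
  [/\ forall u, A u -> R u u,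
      forall u v, A u -> A v -> R u v -> R v u -> u = v,
      forall u v w, A u -> A v -> A w -> R u v -> R v w -> R u w
    & total_on A R].

Definition well_order_on (T : Type) (A : set T) (R : T -> T -> Prop) : Prop :=
  linear_order_on A R /\
  forall B : set T, B `<=` A -> B !=set0 ->
    exists2 m, B m & forall b, B b -> R m b.

Definition pseudointersection (X : set (set nat)) (z : set nat) : Prop :=
  infinite_set z /\ forall x, X x -> almost_subset z x.

Definition ilt (X : set (set nat)) : Prop :=
  [/\ X `<=` inf_reals, linear_order_on X almost_subset
    & ~ exists z, pseudointersection X z].

Definition tower (X : set (set nat)) : Prop :=
  X `<=` inf_reals /\ well_order_on X (fun x y => almost_subset y x).

Definition maximal_tower (X : set (set nat)) : Prop :=
  tower X /\ ~ exists z, pseudointersection X z.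

(* Main.v *)
Require Import Defs.
From mathcomp Require Import all_boot.
From mathcomp Require Import boolp classical_sets cardinality.
From mathcomp Require Import zify.

(* Write the complement of X as {y | exists z, arithmetical(z, y)} and skolemize:
   y is in X iff a tree T_y, arithmetical in y and locally determined by finite
   parts of y, is well-founded.  The ranks of its nodes are ordinals.

   A condition is a finite list of pairs (bit, ordinal) approximating a real y
   together with a decreasing map from T_y to the ordinals.  Conditions are killed
   in stages: p is killed once all its one-step extensions are, or once the
   extensions of p that survive have an infinite common intersection.  Every
   condition is eventually killed: otherwise the survivors would have two branches
   in X that are incomparable for almost inclusion.  Let p be the initial segment
   of (y, ranks of T_y) killed first, say of length k; the common intersection d(y)
   of the conditions below p that survive until then is an infinite subset of y.
   As X is a countable union, some k occurs for a coinitial set of y, and it is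
   fixed.  Then d(y), the label of y, depends only on the first k bits of y and the
   first k ranks of T_y, and these are well-ordered lexicographically, with
   countable initial segments.

   Call y a record if it lies strictly below all members with smaller data.  As no
   label is a pseudointersection of X, records with new labels occur coinitially.
   Keeping for each label d one record, chosen by Novikov-Kondo-Addison
   uniformization, leaves at most one record for each value of the data; these
   form the tower.  All comparisons of ranks and stages are Delta^1_1 on X, since
   the tables of such comparisons are the unique solutions of arithmetical
   recursions. *)

Set Implicit Arguments.
Unset Strict Implicit.
Unset Printing Implicit Defensive.

Local Open Scope classical_set_scope.

(** * Arithmetical definability *)

Fixpoint tsub (s : nat -> aterm) (t : aterm) : aterm :=
  match t with
  | AVar i => s i
  | AZero => AZero
  | AOne => AOne
  | AAdd t1 t2 => AAdd (tsub s t1) (tsub s t2)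
  | AMul t1 t2 => AMul (tsub s t1) (tsub s t2)
  end.

Lemma aeval_tsub e e' s t :
  (forall i, nth 0 e' i = aeval e (s i)) -> aeval e (tsub s t) = aeval e' t.
Proof. by move=> h; elim: t => //= [t1 -> t2 ->|t1 -> t2 ->]. Qed.

Definition tlift : aterm -> aterm := tsub (fun i => AVar i.+1).

Lemma aeval_tlift n e t : aeval (n :: e) (tlift t) = aeval e t.
Proof. exact: aeval_tsub. Qed.

Definition subst_up (s : nat -> aterm) (i : nat) : aterm :=
  if i is j.+1 then tlift (s j) else AVar 0.

Lemma nth_subst_up n e e' s :
  (forall i, nth 0 e' i = aeval e (s i)) ->
  forall i, nth 0 (n :: e') i = aeval (n :: e) (subst_up s i).
Proof. by move=> h [|i] //=; rewrite aeval_tlift h. Qed.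

Fixpoint nsub (s : nat -> aterm) (f : aformula) : aformula :=
  match f with
  | AEq t1 t2 => AEq (tsub s t1) (tsub s t2)
  | ALt t1 t2 => ALt (tsub s t1) (tsub s t2)
  | AMem t i => AMem (tsub s t) i
  | ANot g => ANot (nsub s g)
  | AAnd g h => AAnd (nsub s g) (nsub s h)
  | AForall g => AForall (nsub (subst_up s) g)
  end.

Lemma asat_nsub E f e e' s :
  (forall i, nth 0 e' i = aeval e (s i)) ->
  asat e E (nsub s f) <-> asat e' E f.
Proof.
elim: f e e' s => [t1 t2|t1 t2|t i|g IH|g IHg h IHh|g IH] e e' s hs /=;
  rewrite ?(aeval_tsub _ hs) //.
- by rewrite (IH _ _ _ hs).
- by rewrite (IHg _ _ _ hs) (IHh _ _ _ hs).
- by split=> H n; apply/(IH _ _ _ (nth_subst_up n hs)).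
Qed.

(** Set variable [i] is replaced by the formula [gs i], whose number variable 0 stands for the
    tested element while its other variables are shifted by one. Under a binder they skip the newly
    bound variable as well. *)
Fixpoint asub (s : nat -> aterm) (gs : nat -> aformula) (f : aformula) : aformula :=
  match f with
  | AEq t1 t2 => AEq (tsub s t1) (tsub s t2)
  | ALt t1 t2 => ALt (tsub s t1) (tsub s t2)
  | AMem t i => nsub (fun j => if j is k.+1 then AVar k else tsub s t) (gs i)
  | ANot g => ANot (asub s gs g)
  | AAnd g h => AAnd (asub s gs g) (asub s gs h)
  | AForall g =>
      AForall (asub (subst_up s)
        (fun i => nsub (fun j => if j is k.+1 then AVar k.+2 else AVar 0) (gs i)) g)
  end.

Lemma asat_asub E E' f e e' s gs :
  (forall i, nth 0 e' i = aeval e (s i)) ->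
  (forall i j, nth set0 E' i j <-> asat (j :: e) E (gs i)) ->
  asat e E (asub s gs f) <-> asat e' E' f.
Proof.
elim: f e e' s gs => [t1 t2|t1 t2|t i|g IH|g IHg h IHh|g IH] e e' s gs hs hg /=;
  rewrite ?(aeval_tsub _ hs) //.
- rewrite hg; apply: asat_nsub => -[|k] //=.
  by rewrite (aeval_tsub _ hs).
- by rewrite (IH _ _ _ _ hs hg).
- by rewrite (IHg _ _ _ _ hs hg) (IHh _ _ _ _ hs hg).
- have hg' n i j : nth set0 E' i j <-> asat (j :: n :: e) E
      (nsub (fun j => if j is k.+1 then AVar k.+2 else AVar 0) (gs i)).
    by rewrite hg; symmetry; apply: asat_nsub => -[|k].
  by split=> H n; apply/(IH _ _ _ _ (nth_subst_up n hs) (hg' n)).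
Qed.

(* The predicate [P] on a context [c : C] is arithmetical in the numbers [en c]
   and the sets [ev c]. *)
Definition arith (C : Type) (en : C -> seq nat) (ev : C -> seq (set nat))
    (P : C -> Prop) : Prop :=
  exists f, forall c, P c <-> asat (en c) (ev c) f.

Definition enn (C : Type) (en : C -> seq nat) (p : C * nat) := p.2 :: en p.1.
Definition evn (C : Type) (ev : C -> seq (set nat)) (p : C * nat) := ev p.1.
Definition ens (C : Type) (en : C -> seq nat) (p : C * set nat) := en p.1.
Definition evs (C : Type) (ev : C -> seq (set nat)) (p : C * set nat) := p.2 :: ev p.1.

Definition sdef (C : Type) en ev (U : C -> set nat) :=
  arith (enn en) (evn ev) (fun p => U p.1 p.2).

(** Functions enter through their graphs, so values that no single term expresses, such as entries
    of coded sequences, are allowed. *)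
Definition ndef (C : Type) en ev (t : C -> nat) :=
  arith (enn en) (evn ev) (fun p => t p.1 = p.2).

(** By substitution: numbers of the old context become terms and its sets become formulas over the
    new one. Weakening and the closure properties of analytic predicates are derived from this. *)
Lemma arith_pull (C0 C : Type) en0 ev0 en ev (R : C0 -> Prop) (h : C -> C0) :
  arith en0 ev0 R ->
  (forall i, exists t, forall c, nth 0 (en0 (h c)) i = aeval (en c) t) ->
  (forall i, sdef en ev (fun c => nth set0 (ev0 (h c)) i)) ->
  arith en ev (fun c => R (h c)).
Proof.
move=> [f hf] /choice[s hs] /choice[gs hg].
exists (asub s gs f) => c; rewrite hf; symmetry; apply: asat_asub => // i j.
exact: (hg i (c, j)).
Qed.

Section ArithClosure.
Context (C : Type) (en : C -> seq nat) (ev : C -> seq (set nat)).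
Implicit Types (P Q : C -> Prop) (s t : C -> nat) (U : C -> set nat).

Lemma arith_eqv P Q : (forall c, P c <-> Q c) -> arith en ev Q -> arith en ev P.
Proof. by move=> h [f hf]; exists f => c; rewrite h hf. Qed.

Lemma arith_not P : arith en ev P -> arith en ev (fun c => ~ P c).
Proof. by move=> [f hf]; exists (ANot f) => c; rewrite hf. Qed.

Lemma arith_and P Q :
  arith en ev P -> arith en ev Q -> arith en ev (fun c => P c /\ Q c).
Proof. by move=> [f hf] [g hg]; exists (AAnd f g) => c; rewrite hf hg. Qed.

Lemma arith_or P Q :
  arith en ev P -> arith en ev Q -> arith en ev (fun c => P c \/ Q c).
Proof.
move=> hP hQ; apply: (@arith_eqv _ (fun c => ~ (~ P c /\ ~ Q c))).
  by move=> c; split; [tauto|case/not_andP => /contrapT; tauto].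
by apply: arith_not; apply: arith_and; apply: arith_not.
Qed.

Lemma arith_imp P Q :
  arith en ev P -> arith en ev Q -> arith en ev (fun c => P c -> Q c).
Proof.
move=> hP hQ; apply: (@arith_eqv _ (fun c => ~ P c \/ Q c)).
  by move=> c; split; [case: (pselect (P c)); tauto|tauto].
by apply: arith_or => //; apply: arith_not.
Qed.

Lemma arith_iff P Q :
  arith en ev P -> arith en ev Q -> arith en ev (fun c => P c <-> Q c).
Proof. by move=> hP hQ; apply: arith_and; apply: arith_imp. Qed.

Lemma arith_all (P : C -> nat -> Prop) :
  arith (enn en) (evn ev) (fun p => P p.1 p.2) ->
  arith en ev (fun c => forall n, P c n).
Proof.
move=> [f hf]; exists (AForall f) => c /=.
by split=> H n; apply/(hf (c, n)); apply: H.
Qed.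

Lemma arith_ex (P : C -> nat -> Prop) :
  arith (enn en) (evn ev) (fun p => P p.1 p.2) ->
  arith en ev (fun c => exists n, P c n).
Proof.
move=> [f hf]; exists (ANot (AForall (ANot f))) => c /=.
split=> [[n Pn] /(_ n)|H]; first by apply; apply/(hf (c, n)).
by apply: contrapT => H'; apply: H => n Hn; apply: H'; exists n; apply/(hf (c, n)).
Qed.

Lemma arith_wks P : arith en ev P -> arith (ens en) (evs ev) (fun p => P p.1).
Proof.
move=> h; apply: (arith_pull (h := fst)) h _ _ => i; first by exists (AVar i).
by exists (AMem (AVar 0) i.+1).
Qed.

Lemma ndef_wkn t : ndef en ev t -> ndef (enn en) (evn ev) (fun p => t p.1).
Proof.
move=> h; apply: (arith_pull (h := fun p : C * nat * nat => (p.1.1, p.2))) h _ _ => -[|i].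
- by exists (AVar 0).
- by exists (AVar i.+2).
- by exists (AMem (AVar 0) 0).
- by exists (AMem (AVar 0) i.+1).
Qed.

Lemma ndef_wks t : ndef en ev t -> ndef (ens en) (evs ev) (fun p => t p.1).
Proof.
move=> h; apply: (arith_pull (h := fun p : C * set nat * nat => (p.1.1, p.2))) h _ _ => -[|i].
- by exists (AVar 0).
- by exists (AVar i.+1).
- by exists (AMem (AVar 0) 1).
- by exists (AMem (AVar 0) i.+2).
Qed.

Lemma sdef_wkn U : sdef en ev U -> sdef (enn en) (evn ev) (fun p => U p.1).
Proof.
move=> h; apply: (arith_pull (h := fun p : C * nat * nat => (p.1.1, p.2))) h _ _ => -[|i].
- by exists (AVar 0).
- by exists (AVar i.+2).
- by exists (AMem (AVar 0) 0).
- by exists (AMem (AVar 0) i.+1).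
Qed.

Lemma sdef_wks U : sdef en ev U -> sdef (ens en) (evs ev) (fun p => U p.1).
Proof.
move=> h; apply: (arith_pull (h := fun p : C * set nat * nat => (p.1.1, p.2))) h _ _ => -[|i].
- by exists (AVar 0).
- by exists (AVar i.+1).
- by exists (AMem (AVar 0) 1).
- by exists (AMem (AVar 0) i.+2).
Qed.

Lemma ndef_bound : ndef (enn en) (evn ev) snd.
Proof. by exists (AEq (AVar 1) (AVar 0)). Qed.

Lemma sdef_bound : sdef (ens en) (evs ev) snd.
Proof. by exists (AMem (AVar 0) 0). Qed.

End ArithClosure.

Section ArithMem.
Context (C : Type) (en : C -> seq nat) (ev : C -> seq (set nat)).
Implicit Types (t : C -> nat) (U : C -> set nat).

Lemma arith_app (R : C -> nat -> Prop) t :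
  ndef en ev t -> arith (enn en) (evn ev) (fun p => R p.1 p.2) ->
  arith en ev (fun c => R c (t c)).
Proof.
move=> ht hR; apply: (arith_eqv (Q := fun c => exists n, t c = n /\ R c n)).
  by move=> c; split=> [h|[n [<- ?]]//]; exists (t c).
by apply: arith_ex; apply: arith_and.
Qed.

Lemma arith_mem U t : sdef en ev U -> ndef en ev t -> arith en ev (fun c => U c (t c)).
Proof. by move=> hU ht; apply: arith_app ht _. Qed.

End ArithMem.

Section ArithAtoms.
Context (C : Type) (en : C -> seq nat) (ev : C -> seq (set nat)).
Implicit Types (s t : C -> nat) (U : C -> set nat).

Lemma arith_app2 (R : nat -> nat -> Prop) s t :
  arith (enn (enn en)) (evn (evn ev)) (fun p => R p.1.2 p.2) ->
  ndef en ev s -> ndef en ev t -> arith en ev (fun c => R (s c) (t c)).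
Proof.
move=> hR hs ht; apply: (arith_app (R := fun c n => R n (t c))) hs _.
exact: (arith_app (R := fun p n => R p.2 n)) (ndef_wkn ht) _.
Qed.

Lemma arith_eq s t : ndef en ev s -> ndef en ev t -> arith en ev (fun c => s c = t c).
Proof. by apply: (arith_app2 (R := eq)); exists (AEq (AVar 1) (AVar 0)). Qed.

Lemma arith_lt s t : ndef en ev s -> ndef en ev t -> arith en ev (fun c => s c < t c).
Proof. by apply: (arith_app2 (R := fun a b => a < b)); exists (ALt (AVar 1) (AVar 0)). Qed.

Lemma arith_le s t : ndef en ev s -> ndef en ev t -> arith en ev (fun c => s c <= t c).
Proof.
move=> hs ht; apply: (arith_eqv (Q := fun c => s c < t c \/ s c = t c)).
  move=> c; split; last by lia.
  by rewrite leq_eqVlt => /orP[/eqP|]; [right|left].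
by apply: arith_or; [apply: arith_lt|apply: arith_eq].
Qed.

Lemma ndef_app2 (F : nat -> nat -> nat) s t :
  (exists tm, forall a b e, aeval (b :: a :: e) tm = F a b) ->
  ndef en ev s -> ndef en ev t -> ndef en ev (fun c => F (s c) (t c)).
Proof.
move=> [tm htm] hs ht.
apply: (arith_app (R := fun p n => F n (t p.1) = p.2)) (ndef_wkn hs) _.
apply: (arith_app (R := fun p n => F p.2 n = p.1.2)) (ndef_wkn (ndef_wkn ht)) _.
by exists (AEq tm (AVar 2)) => -[[[c a] b] d] /=; rewrite htm.
Qed.

Lemma ndef_add s t : ndef en ev s -> ndef en ev t -> ndef en ev (fun c => s c + t c).
Proof. by apply: (ndef_app2 (F := addn)); exists (AAdd (AVar 1) (AVar 0)). Qed.

Lemma ndef_mul s t : ndef en ev s -> ndef en ev t -> ndef en ev (fun c => s c * t c).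
Proof. by apply: (ndef_app2 (F := muln)); exists (AMul (AVar 1) (AVar 0)). Qed.

Lemma ndef_S s : ndef en ev s -> ndef en ev (fun c => (s c).+1).
Proof.
move=> hs; apply: (ndef_app2 (F := fun a _ => a.+1)) (hs) hs.
by exists (AAdd (AVar 1) AOne) => a b e /=; rewrite addn1.
Qed.

Lemma ndef_0 : ndef en ev (fun _ => 0).
Proof. by exists (AEq AZero (AVar 0)). Qed.

Lemma ndef_const n : ndef en ev (fun _ => n).
Proof. by elim: n => [|n IH]; [exact: ndef_0|exact: ndef_S IH]. Qed.

End ArithAtoms.

(* Drops the most recent variable if the body does not mention it. *)
Ltac weaken_n L :=
  match goal with
  | |- _ (@enn ?C ?en) (@evn _ ?ev) ?f =>
      let t := eval cbn [fst snd] in (fun (c : C) (n : nat) => f (c, n)) in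
      match t with (fun c _ => @?u c) => refine (@L C en ev u _) end
  end.

Ltac weaken_s L :=
  match goal with
  | |- _ (@ens ?C ?en) (@evs _ ?ev) ?f =>
      let t := eval cbn [fst snd] in (fun (c : C) (Z : set nat) => f (c, Z)) in
      match t with (fun c _ => @?u c) => refine (@L C en ev u _) end
  end.

Ltac ar_mem :=
  match goal with
  | |- @arith ?C ?en ?ev ?P =>
      let p := constr:(fun c : C => ltac:(
        let b := eval cbv beta in (P c) in
        match b with ?u ?t => exact (u, t) end)) in
      match p with
      | (fun c => (@?U c, @?t c)) => refine (@arith_mem C en ev U t _ _)
      end
  end.

(** A hook, redefined as closure lemmas for further operations become available. *)
Ltac ar_atom := fail.

Ltac ar_step :=
  cbv beta;
  first
  [ assumption
  | match goal with h : forall _ : nat, _ |- _ => exact (h _) end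
  | match goal with
    | |- ndef _ _ _ => first
       [ apply: ndef_bound | weaken_n ndef_wkn | weaken_s ndef_wks ]
    | |- ndef _ _ (fun _ => _ + _) => apply: ndef_add
    | |- ndef _ _ (fun _ => _ * _) => apply: ndef_mul
    | |- ndef _ _ (fun _ => ?n) => exact: ndef_const
    | |- ndef _ _ (fun _ => _.+1) => apply: ndef_S
    | |- sdef _ _ _ => first
       [ apply: sdef_bound | weaken_n sdef_wkn | weaken_s sdef_wks ]
    end
  | ar_atom
  | match goal with
    | |- arith _ _ (fun _ => _ /\ _) => apply: arith_and
    | |- arith _ _ (fun _ => _ \/ _) => apply: arith_or
    | |- arith _ _ (fun _ => _ <-> _) => apply: arith_iff
    | |- arith _ _ (fun _ => ~ _) => apply: arith_not
    | |- arith _ _ (fun _ => exists _, _) => apply: arith_ex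
    | |- arith _ _ (fun _ => forall _ : nat, _) => apply: arith_all
    | |- arith _ _ (fun _ => _ -> _) => apply: arith_imp
    | |- arith _ _ (fun _ => @eq nat _ _) => apply: arith_eq
    | |- arith _ _ (fun _ => is_true (_ < _)) => apply: arith_lt
    | |- arith _ _ (fun _ => is_true (_ <= _)) => apply: arith_le
    | |- arith _ _ _ => ar_mem
    | |- sdef _ _ _ => unfold sdef
    end ].
Ltac ar := repeat ar_step.

(** * Coding of finite sequences *)

(* Injective, and given by a term of the language. *)
Definition cpair (a b : nat) : nat := (a + b) * (a + b) + a.

(** The code lies between the consecutive squares $(a+b)^2$ and $(a+b+1)^2$, so it determines $a+b$
    and then $a$. *)
Lemma cpair_inj a b c d : cpair a b = cpair c d -> a = c /\ b = d.
Proof.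
rewrite /cpair => h.
have [lt|lt|e] := ltngtP (a + b) (c + d).
- by have := leq_mul lt lt; lia.
- by have := leq_mul lt lt; lia.
by move: h; rewrite e => /addnI ac; split=> //; lia.
Qed.

Lemma chinese_seq (m v : nat -> nat) k :
  (forall i j, i < j < k -> coprime (m i) (m j)) ->
  exists a, forall i, i < k -> a = v i %[mod m i].
Proof.
elim: k => [|k IH] co; first by exists 0.
have [|a ha] := IH; first by move=> i j h; apply: co; lia.
have coP : coprime (\prod_(i < k) m i) (m k).
  apply: (big_ind (fun x => coprime x (m k))); first exact: coprime1n.
  - by move=> x y hx hy; rewrite coprimeMl hx.
  - by move=> i _; apply: co; rewrite ltn_ord /=.
exists (chinese (\prod_(i < k) m i) (m k) a (v k)) => i.
rewrite ltnS leq_eqVlt => /orP[/eqP->|lik]; first exact: chinese_modr.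
rewrite -ha //; have dv : m i %| \prod_(i < k) m i.
  by rewrite (bigD1 (Ordinal lik)) //= dvdn_mulr.
by rewrite -(modn_dvdm _ dv) chinese_modl // modn_dvdm.
Qed.

(** The moduli of Gödel's beta function. *)
Definition beta_mod (b i : nat) : nat := (i.+1 * b).+1.

(** A common divisor is coprime to [n!] and divides [(j - i) * n!], hence divides [j - i], hence
    [n!]; so it is 1. *)
Lemma beta_coprime n i j : i < j < n -> coprime (beta_mod n`! i) (beta_mod n`! j).
Proof.
move=> h; rewrite /coprime; set g := gcdn _ _.
have gi : g %| beta_mod n`! i by exact: dvdn_gcdl.
have gj : g %| beta_mod n`! j by exact: dvdn_gcdr.
have gb : coprime g n`!.
  apply: (coprime_dvdl gi).
  by rewrite /beta_mod -[(_ * _).+1]addn1 /coprime gcdnC gcdnMDl gcdn1.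
have : g %| (j - i) * n`!.
  suff -> : (j - i) * n`! = beta_mod n`! j - beta_mod n`! i by apply: dvdn_sub.
  by rewrite /beta_mod subSS -mulnBl subSS.
rewrite Gauss_dvdl // => gji.
have : g %| n`! by apply: (dvdn_trans gji); apply: dvdn_fact; lia.
by move=> gn; move: gb; rewrite /coprime (gcdn_idPl gn).
Qed.

Definition scode (k a b : nat) : nat := cpair k (cpair a b).

(** A code stores the length and the two parameters of the beta function; every other number decodes
    to the empty sequence. *)
Definition decode (c : nat) : seq nat :=
  if pselect (exists p : nat * nat * nat, c = scode p.1.1 p.1.2 p.2) is left h then
    let p := sval (cid h) in mkseq (fun i => p.1.2 %% beta_mod p.2 i) p.1.1
  else [::].

Lemma decodeE k a b : decode (scode k a b) = mkseq (fun i => a %% beta_mod b i) k.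
Proof.
rewrite /decode; case: pselect => [h|[]]; last by exists (k, a, b).
case: cid => -[[k' a'] b'] /=.
by rewrite /scode => /cpair_inj[-> /cpair_inj[-> ->]].
Qed.

Lemma decode0 c : (~ exists k a b, c = scode k a b) -> decode c = [::].
Proof.
rewrite /decode; case: pselect => // -[[[k a] b] h []].
by exists k, a, b.
Qed.

Lemma decode_surj s : exists c, decode c = s.
Proof.
(* Being at least the length, [n] makes the moduli coprime; being at least every entry, it makes the
   entries smaller than the moduli. *)
set n := (size s + \max_(i < size s) nth 0 s i).
have [i j|a ha] := @chinese_seq (beta_mod n`!) (nth 0 s) (size s).
  by move=> h; apply: beta_coprime; rewrite /n; lia.
exists (scode (size s) a n`!); rewrite decodeE.
apply: (@eq_from_nth _ 0); rewrite size_mkseq // => i hi.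
rewrite nth_mkseq // ha // modn_small // /beta_mod ltnS.
have : nth 0 s i <= n.
  rewrite /n (leq_trans _ (leq_addl _ _)) //.
  exact: (leq_bigmax (F := fun i : 'I_(size s) => nth 0 s i) (Ordinal hi)).
move=> h; apply: (leq_trans h); rewrite -[n in n <= _]mul1n leq_mul //.
by case: (n) => // m; apply: dvdn_leq; [apply: fact_gt0|apply: dvdn_fact; rewrite /= leqnn].
Qed.

(** Used for the locality of the tree: a node with code [c] inspects only bits of the real below
    [c]. *)
Lemma size_decode_le c : size (decode c) <= c.
Proof.
have [[k [a [b ->]]]|/decode0->//] := pselect (exists k a b, c = scode k a b).
by rewrite decodeE size_mkseq /scode /cpair; nia.
Qed.

Definition ent (c i : nat) : nat := nth 0 (decode c) i.

Definition agree (N : nat) (y z : set nat) : Prop := forall m, m < N -> (y m <-> z m).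

Section CodingDefinable.
Context (C : Type) (en : C -> seq nat) (ev : C -> seq (set nat)).
Implicit Types (s t : C -> nat).

Lemma ndef_cpair s t :
  ndef en ev s -> ndef en ev t -> ndef en ev (fun c => cpair (s c) (t c)).
Proof. by move=> *; rewrite /cpair; ar. Qed.

Lemma ndef_scode k s t :
  ndef en ev k -> ndef en ev s -> ndef en ev t ->
  ndef en ev (fun c => scode (k c) (s c) (t c)).
Proof. by move=> *; rewrite /scode /cpair; ar. Qed.

Lemma ndef_beta s t :
  ndef en ev s -> ndef en ev t -> ndef en ev (fun c => beta_mod (s c) (t c)).
Proof. by move=> *; rewrite /beta_mod; ar. Qed.

End CodingDefinable.

Ltac ar_atom ::=
  match goal with
  | |- ndef _ _ (fun _ => cpair _ _) => apply: ndef_cpair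
  | |- ndef _ _ (fun _ => scode _ _ _) => apply: ndef_scode
  | |- ndef _ _ (fun _ => beta_mod _ _) => apply: ndef_beta
  end.

Lemma size_decodeP c k : size (decode c) = k <->
  (exists a b, c = scode k a b) \/ (k = 0 /\ ~ exists k a b, c = scode k a b).
Proof.
have [[k' [a [b ->]]]|h] := pselect (exists k a b, c = scode k a b).
  rewrite decodeE size_mkseq; split=> [<-|]; first by left; exists a, b.
  case=> [[a' [b' /cpair_inj[]//]]|[_ []]].
  by exists k', a, b.
rewrite decode0 //=; split=> [<-|]; first by right.
by case=> [[a [b e]]|[]//]; case: h; exists k, a, b.
Qed.

(** An arithmetical form of the graph of [ent]: the remainder is described by a quotient [q], and
    the default value 0 covers positions past the end and numbers that are not codes. *)
Lemma entP c i v : ent c i = v <->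
  (exists k a b q, c = scode k a b /\ i < k /\ v < beta_mod b i /\ a = q * beta_mod b i + v)
  \/ (v = 0 /\ ~ exists k a b, c = scode k a b /\ i < k).
Proof.
rewrite /ent.
have [[k [a [b [-> ik]]]]|h] := pselect (exists k a b, c = scode k a b /\ i < k).
  rewrite decodeE nth_mkseq //; split=> [<-|].
    left; exists k, a, b, (a %/ beta_mod b i); split=> //; split=> //.
    by rewrite ltn_mod -divn_eq.
  case=> [[k' [a' [b' [q [/cpair_inj[_ /cpair_inj[<- <-]] [_ [lv ->]]]]]]]|[_ []]].
    by rewrite modnMDl modn_small.
  by exists k, a, b.
have -> : nth 0 (decode c) i = 0.
  have [[k [a [b e]]]|/decode0->] := pselect (exists k a b, c = scode k a b).
    rewrite nth_default // e decodeE size_mkseq leqNgt.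
    by apply/negP => ?; apply: h; exists k, a, b.
  by rewrite nth_nil.
split=> [<-|]; first by right.
case=> [[k [a [b [q [e [ik _]]]]]]|[]//]; by case: h; exists k, a, b.
Qed.

Section CodingDefinable2.
Context (C : Type) (en : C -> seq nat) (ev : C -> seq (set nat)).
Implicit Types (s t : C -> nat).

Lemma ndef_size_decode s :
  ndef en ev s -> ndef en ev (fun c => size (decode (s c))).
Proof.
move=> hs; rewrite /ndef; apply: arith_eqv; first by move=> p; apply: size_decodeP.
by ar.
Qed.

Lemma ndef_ent s t :
  ndef en ev s -> ndef en ev t -> ndef en ev (fun c => ent (s c) (t c)).
Proof.
move=> hs ht; rewrite /ndef; apply: arith_eqv; first by move=> p; apply: entP.
by ar.
Qed.

End CodingDefinable2.

Ltac ar_atom ::=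
  match goal with
  | |- ndef _ _ (fun _ => cpair _ _) => apply: ndef_cpair
  | |- ndef _ _ (fun _ => size (decode _)) => apply: ndef_size_decode
  | |- ndef _ _ (fun _ => ent _ _) => apply: ndef_ent
  end.

(** * Joins and columns of reals *)

Definition part (b : nat) (G : set nat) : set nat := fun j => G (2 * j + b).
Definition shift (G : set nat) : set nat := fun j => G j.+1.
Definition column (n : nat) (G : set nat) : set nat := fun j => G (cpair n j).

Definition join (G H : set nat) : set nat :=
  fun m => (exists j, m = 2 * j /\ G j) \/ (exists j, m = 2 * j + 1 /\ H j).

Lemma part0_join G H : part 0 (join G H) = G.
Proof.
apply/funext => j; apply/propext; rewrite /part; split.
  by case=> -[i [e]]; [have -> : i = j by lia|lia].
by left; exists j; split; [lia|].
Qed.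

Lemma part1_join G H : part 1 (join G H) = H.
Proof.
apply/funext => j; apply/propext; rewrite /part; split.
  by case=> -[i [e]]; [lia|have -> : i = j by lia].
by right; exists j; split; [lia|].
Qed.

Lemma join_part G : join (part 0 G) (part 1 G) = G.
Proof.
apply/funext => j; apply/propext; rewrite /part /join; split.
  by case=> -[i [->]]; rewrite ?addn0.
have := odd_double_half j; case: odd => e Gj.
  by right; exists j./2; split; [lia|have <- : j = 2 * j./2 + 1 by lia].
by left; exists j./2; split; [lia|have <- : j = 2 * j./2 + 0 by lia].
Qed.

Definition columns (Gs : nat -> set nat) : set nat :=
  fun m => exists n j, m = cpair n j /\ Gs n j.

Lemma column_columns n Gs : column n (columns Gs) = Gs n.
Proof.
apply/funext => j; apply/propext; rewrite /column; split.
  by move=> [i [k [/cpair_inj[-> ->]]]].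
by exists n, j.
Qed.

Section SetOpsDefinable.
Context (C : Type) (en : C -> seq nat) (ev : C -> seq (set nat)).

Lemma sdef_part b G : sdef en ev G -> sdef en ev (fun c => part b (G c)).
Proof. by move=> ?; rewrite /part; ar. Qed.

Lemma sdef_shift G : sdef en ev G -> sdef en ev (fun c => shift (G c)).
Proof. by move=> ?; rewrite /shift; ar. Qed.

Lemma sdef_column n G :
  ndef en ev n -> sdef en ev G -> sdef en ev (fun c => column (n c) (G c)).
Proof. by move=> ? ?; rewrite /column; ar. Qed.

Lemma sdef_join G H :
  sdef en ev G -> sdef en ev H -> sdef en ev (fun c => join (G c) (H c)).
Proof. by move=> ? ?; rewrite /join; ar. Qed.

Definition tdef (t : C -> nat) := exists tm, forall c, t c = aeval (en c) tm.

Lemma ndef_tdef t : tdef t -> ndef en ev t.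
Proof.
move=> [tm h]; exists (AEq (tlift tm) (AVar 0)) => -[c n] /=.
by rewrite aeval_tlift h.
Qed.

Lemma tdef_aeval e t :
  (forall i, tdef (fun c => nth 0 (e c) i)) -> tdef (fun c => aeval (e c) t).
Proof.
move=> /choice[s hs]; exists (tsub s t) => c.
by symmetry; apply: aeval_tsub => i; apply: hs.
Qed.

End SetOpsDefinable.

Lemma tdef_wkn C (en : C -> seq nat) t : tdef en t -> tdef (enn en) (fun p => t p.1).
Proof. by move=> [tm h]; exists (tlift tm) => -[c n]; rewrite aeval_tlift h. Qed.

Lemma tdef_bound C (en : C -> seq nat) : tdef (enn en) snd.
Proof. by exists (AVar 0). Qed.

Ltac weaken_t :=
  match goal with
  | |- tdef (@enn ?C ?en) ?f =>
      let t := eval cbn [fst snd] in (fun (c : C) (n : nat) => f (c, n)) in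
      match t with (fun c _ => @?u c) => refine (@tdef_wkn C en u _) end
  end.

Ltac ar_atom ::=
  match goal with
  | |- ndef _ _ (fun _ => cpair _ _) => apply: ndef_cpair
  | |- ndef _ _ (fun _ => size (decode _)) => apply: ndef_size_decode
  | |- ndef _ _ (fun _ => ent _ _) => apply: ndef_ent
  | |- sdef _ _ (fun _ => part _ _) => apply: sdef_part
  | |- sdef _ _ (fun _ => shift _) => apply: sdef_shift
  | |- sdef _ _ (fun _ => column _ _) => apply: sdef_column
  | |- sdef _ _ (fun _ => join _ _) => apply: sdef_join
  | |- tdef _ _ => first [ exact: tdef_bound | weaken_t ]
  end.

(** * A normal form for arithmetical predicates *)

(** The arguments are the bound on the tested instances, the bound on the inspected part of the
    sets, the number valuation, the Skolem data and the set valuation. *)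
Definition approx := nat -> nat -> seq nat -> set nat -> seq (set nat) -> Prop.

Definition arithD (D : approx) : Prop :=
  forall C (en : C -> seq nat) (ev : C -> seq (set nat)) l l' e G E,
  ndef en ev l -> ndef en ev l' ->
  (forall i, tdef en (fun c => nth 0 (e c) i)) ->
  sdef en ev G -> (forall i, sdef en ev (fun c => nth set0 (E c) i)) ->
  arith en ev (fun c => D (l c) (l' c) (e c) (G c) (E c)).

Definition monoD (D : approx) : Prop := forall l l' k k' e G E,
  D l l' e G E -> k <= l -> l' <= k' -> D k k' e G E.

Definition localD (D : approx) : Prop := forall l l' e G G' E E',
  agree l' G G' -> (forall i, agree l' (nth set0 E i) (nth set0 E' i)) ->
  D l l' e G E -> D l l' e G' E'.

(* A skolemization: [G] holds the Skolem data of the predicate, and the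
   instances of [P] below [l] are verified by the part of the sets below [l']. *)
Definition NF (P : seq nat -> seq (set nat) -> Prop) : Prop :=
  exists D : approx, [/\ arithD D, monoD D, localD D &
    forall e E, P e E <-> exists G, forall l, exists l', D l l' e G E].

Lemma NF_eqv P Q : (forall e E, P e E <-> Q e E) -> NF P -> NF Q.
Proof. by move=> h [D [? ? ? s]]; exists D; split=> // e E; rewrite -h s. Qed.

Lemma NF_eval (R : seq nat -> Prop) :
  (forall C (en : C -> seq nat) ev e, (forall i, tdef en (fun c => nth 0 (e c) i)) ->
     arith en ev (fun c => R (e c))) ->
  NF (fun e _ => R e).
Proof.
move=> hR; exists (fun _ _ e _ _ => R e); split=> //.
  by move=> *; apply: hR.
move=> e E; split=> [h|[G /(_ 0)[]]//].
by exists set0 => l; exists 0.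
Qed.

Lemma NF_mem t i b : NF (fun e E => if b then nth set0 E i (aeval e t)
                                   else ~ nth set0 E i (aeval e t)).
Proof.
exists (fun _ l' e _ E => aeval e t < l' /\
  (if b then nth set0 E i (aeval e t) else ~ nth set0 E i (aeval e t))); split.
- move=> C en ev l l' e G E hl hl' he hG hE.
  have h : ndef en ev (fun c => aeval (e c) t) by exact: (ndef_tdef _ (tdef_aeval _ he)).
  apply: arith_and; first by ar.
  have hm : arith en ev (fun c => nth set0 (E c) i (aeval (e c) t)) by exact: arith_mem (hE i) h.
  by case: b => //; apply: arith_not.
- by move=> l l' k k' e G E [h1 h2] _ h3; split=> //; lia.
- move=> l l' e G G' E E' _ aE [h1]; have := aE i _ h1.
  by case: b => h h2; split=> //; rewrite -h.
- move=> e E; split=> [h|[G /(_ 0)[? []]]//].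
  by exists set0 => l; exists (aeval e t).+1.
Qed.

Lemma agree_part N k b G G' : agree N G G' -> b < 2 -> 2 * k <= N ->
  agree k (part b G) (part b G').
Proof. by move=> a lb h m lm; apply: a; lia. Qed.

Lemma agree_le N k G G' : agree N G G' -> k <= N -> agree k G G'.
Proof. by move=> a h m lm; apply: a; lia. Qed.

(** The two halves of [G] hold the data of the two conjuncts; inspecting both up to [k] inspects [G]
    up to [2 * k]. *)
Lemma NF_and P Q : NF P -> NF Q -> NF (fun e E => P e E /\ Q e E).
Proof.
move=> [D1 [a1 m1 l1 s1]] [D2 [a2 m2 l2 s2]].
exists (fun l l' e G E => exists k, 2 * k <= l' /\
  (D1 l k e (part 0 G) E /\ D2 l k e (part 1 G) E)); split.
- move=> C en ev l l' e G E hl hl' he hG hE; ar; [apply: a1|apply: a2]; intros; ar.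
- move=> l l' k k' e G E [n [h [h1 h2]]] lk lk'; exists n; split; first lia.
  by split; [apply: m1 h1 _ _|apply: m2 h2 _ _].
- move=> l l' e G G' E E' aG aE [n [h [h1 h2]]]; exists n; split=> //.
  have aE' i : agree n (nth set0 E i) (nth set0 E' i) by apply: agree_le (aE i) _; lia.
  split; [apply: l1 h1 => //|apply: l2 h2 => //]; exact: agree_part aG _ h.
- move=> e E; rewrite s1 s2; split=> [[[G h1] [H h2]]|[G h]].
    exists (join G H) => l; have [k1 d1] := h1 l; have [k2 d2] := h2 l.
    exists (2 * maxn k1 k2), (maxn k1 k2); split=> //.
    rewrite part0_join part1_join; split.
      by apply: m1 d1 _ _ => //; lia.
    by apply: m2 d2 _ _ => //; lia.
  split; [exists (part 0 G)|exists (part 1 G)] => l;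
    by have [l' [k [_ [? ?]]]] := h l; exists k.
Qed.

(** The first bit of [G] selects the disjunct, and the remaining bits hold its data. *)
Lemma NF_or P Q : NF P -> NF Q -> NF (fun e E => P e E \/ Q e E).
Proof.
move=> [D1 [a1 m1 l1 s1]] [D2 [a2 m2 l2 s2]].
exists (fun l l' e G E => exists k, k < l' /\
  ((G 0 -> D1 l k e (shift G) E) /\ (~ G 0 -> D2 l k e (shift G) E))); split.
- move=> C en ev l l' e G E hl hl' he hG hE; ar; [apply: a1|apply: a2]; intros; ar.
- move=> l l' k k' e G E [n [h [h1 h2]]] lk lk'; exists n; split; first lia.
  by split=> g; [apply: m1 (h1 g) _ _|apply: m2 (h2 g) _ _].
- move=> l l' e G G' E E' aG aE [n [h [h1 h2]]]; exists n; split=> //.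
  have aE' i : agree n (nth set0 E i) (nth set0 E' i) by apply: agree_le (aE i) _; lia.
  have aG' : agree n (shift G) (shift G') by move=> m lm; apply: aG; lia.
  rewrite -(aG 0); last lia.
  by split=> g; [apply: l1 (h1 g)|apply: l2 (h2 g)].
- move=> e E; rewrite s1 s2; split=> [[[G h]|[G h]]|[G h]].
  + exists (fun m => if m is j.+1 then G j else True) => l; have [k d] := h l.
    by exists k.+1, k.
  + exists (fun m => if m is j.+1 then G j else False) => l; have [k d] := h l.
    by exists k.+1, k.
  + have [g|g] := pselect (G 0); [left|right]; exists (shift G) => l;
      by have [l' [k [_ [? ?]]]] := h l; exists k; auto.
Qed.

Lemma NF_exset Q : NF Q -> NF (fun e E => exists Z, Q e (Z :: E)).
Proof.
move=> [D [a m lo s]].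
exists (fun l l' e G E => exists k, 2 * k <= l' /\
  D l k e (part 0 G) (part 1 G :: E)); split.
- move=> C en ev l l' e G E hl hl' he hG hE; ar; apply: a; last (case=> [|i] /=); intros; ar.
- move=> l l' k k' e G E [n [h h1]] lk lk'; exists n; split; first lia.
  exact: m h1 _ _.
- move=> l l' e G G' E E' aG aE [n [h h1]]; exists n; split=> //.
  apply: lo h1 => [|[|i]] /=; try exact: agree_part aG _ h.
  by apply: agree_le (aE i) _; lia.
- move=> e E; split=> [[Z /s[G h]]|[G h]].
    exists (join G Z) => l; have [k d] := h l.
    by exists (2 * k), k; rewrite part0_join part1_join.
  exists (part 1 G); apply/s; exists (part 0 G) => l.
  by have [l' [k [_ ?]]] := h l; exists k.
Qed.

(** The witness is given by [part 0 G], which must have an element found below [k]; each of its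
    elements below [l] is tested as a witness. *)
Lemma NF_ex Q : NF Q -> NF (fun e E => exists n, Q (n :: e) E).
Proof.
move=> [D [a m lo s]].
exists (fun l l' e G E => exists k, 2 * (l + k) <= l' /\
  ((exists n, n < k /\ part 0 G n) /\
   forall n, n < l -> part 0 G n -> D l k (n :: e) (part 1 G) E)); split.
- move=> C en ev l l' e G E hl hl' he hG hE; ar; apply: a;
    [ | |case=> [|i] /=| | ]; intros; ar.
- move=> l l' k k' e G E [n [h [h1 h2]]] lk lk'; exists n; split; first lia.
  split=> // i li Gi; apply: m (h2 i _ Gi) _ _ => //; lia.
- move=> l l' e G G' E E' aG aE [n [h [[i [lin Gi]] h2]]].
  have aG0 j : j < l + n -> part 0 G j <-> part 0 G' j by move=> ?; apply: aG; lia.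
  exists n; split=> //; split.
    by exists i; split=> //; apply/aG0 => //; lia.
  move=> j lj /aG0 Gj; apply: lo (h2 j lj _); last by apply: Gj; lia.
    by apply: agree_part aG _ _; lia.
  by move=> i'; apply: agree_le (aE i') _; lia.
- move=> e E; split=> [[n /s[G h]]|[G h]].
    exists (join (fun j => j = n) G) => l; have [k d] := h l.
    exists (2 * (l + maxn k n.+1)), (maxn k n.+1); split=> //.
    rewrite part0_join part1_join; split; first by exists n; split; [lia|].
    by move=> j _ ->; apply: m d _ _ => //; lia.
  have [l' [k [_ [[n [_ Gn]] _]]]] := h 0.
  exists n; apply/s; exists (part 1 G) => l.
  have [l1 [k1 [_ [_ /(_ n)]]]] := h (maxn l n.+1) => d; exists k1.
  by apply: m (d _ Gn) _ _; lia.
Qed.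

(** Column [n] of [G] holds the data of instance [n]. Only the instances below [l] are tested, so a
    single bound [k] serves all of them. *)
Lemma NF_all Q : NF Q -> NF (fun e E => forall n, Q (n :: e) E).
Proof.
move=> [D [a m lo s]].
exists (fun l l' e G E => exists k, cpair l k + k <= l' /\
  forall n, n < l -> D l k (n :: e) (column n G) E); split.
- move=> C en ev l l' e G E hl hl' he hG hE; ar; apply: a;
    [ | |case=> [|i] /=| | ]; intros; ar.
- move=> l l' k k' e G E [n [h h2]] lk lk'; exists n; split.
    have := leq_mul (leq_add lk (leqnn n)) (leq_add lk (leqnn n)).
    by move: h; rewrite /cpair; lia.
  by move=> i li; apply: m (h2 i _) _ _ => //; lia.
- move=> l l' e G G' E E' aG aE [n [h h2]]; exists n; split=> // i li.
  apply: lo (h2 i li) => [j lj|i']; last by apply: agree_le (aE i') _; lia.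
  apply: aG; have h3 : i + j <= l + n by lia.
  by have := leq_mul h3 h3; move: h; rewrite /cpair; lia.
- move=> e E; split=> [h|[G h] n].
    have /choice[Gs hGs] : forall n, exists G, forall l, exists l', D l l' (n :: e) G E.
      by move=> n; apply/s.
    exists (columns Gs) => l.
    have /choice[ks hks] : forall n, exists k, D l k (n :: e) (Gs n) E by move=> n.
    pose k := \max_(i < l) ks i.
    exists (cpair l k + k), k; split=> // n ln; rewrite column_columns.
    by apply: (m _ _ _ _ _ _ _ (hks n)) => //;
      apply: (leq_bigmax (F := fun i : 'I_l => ks i) (Ordinal ln)).
  apply/s; exists (column n G) => l.
  have [l1 [k1 [_ /(_ n)]]] := h (maxn l n.+1) => d; exists k1.
  by apply: (m _ _ _ _ _ _ _ (d _)); lia.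
Qed.

(** A formula and its negation are treated together, so that negations are pushed down to the
    atoms. *)
Lemma NF_formula f : NF (fun e E => asat e E f) /\ NF (fun e E => ~ asat e E f).
Proof.
elim: f => [t1 t2|t1 t2|t i|g [IHp IHn]|g [gp gn] h [hp hn]|g [IHp IHn]] /=.
- have ha C (en : C -> seq nat) ev e : (forall i, tdef en (fun c => nth 0 (e c) i)) ->
      arith en ev (fun c => aeval (e c) t1 = aeval (e c) t2).
    by move=> he; apply: arith_eq; exact: (ndef_tdef _ (tdef_aeval _ he)).
  by split; apply: NF_eval => // *; apply: arith_not; apply: ha.
- have ha C (en : C -> seq nat) ev e : (forall i, tdef en (fun c => nth 0 (e c) i)) ->
      arith en ev (fun c => aeval (e c) t1 < aeval (e c) t2).
    by move=> he; apply: arith_lt; exact: (ndef_tdef _ (tdef_aeval _ he)).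
  by split; apply: NF_eval => // *; apply: arith_not; apply: ha.
- by split; [exact: (NF_mem t i true)|exact: (NF_mem t i false)].
- by split=> //; apply: NF_eqv IHp => e E; split=> [? //|/contrapT].
- split; first exact: NF_and gp hp.
  by apply: NF_eqv (NF_or gn hn) => e E; rewrite not_andE.
- split; first exact: NF_all IHp.
  by apply: NF_eqv (NF_ex IHn) => e E; exact: existsNP.
Qed.

(** * Trees for co-analytic sets *)

Lemma dep_choice (T : Type) (P : T -> Prop) (R : T -> T -> Prop) x0 :
  P x0 -> (forall x, P x -> exists y, P y /\ R x y) ->
  exists f : nat -> T, f 0 = x0 /\ forall n, P (f n) /\ R (f n) (f n.+1).
Proof.
move=> P0 step.
pose S (u v : {x | P x}) := R (sval u) (sval v).
have hS u : {v | S u v}.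
  apply: cid; case: u => x Px; have [y [Py Rxy]] := step x Px.
  by exists (exist _ y Py).
have [f [f0 fS]] := dependent_choice hS (exist _ x0 P0).
exists (fun n => sval (f n)); rewrite f0; split=> // n; split; first exact: svalP.
exact: fS.
Qed.

Lemma not_Acc_path (T : Type) (R : T -> T -> Prop) x :
  ~ Acc R x -> exists f, f 0 = x /\ forall n, R (f n.+1) (f n).
Proof.
move=> nA; have [|f [f0 h]] := @dep_choice _ (fun x => ~ Acc R x) (fun x y => R y x) _ nA.
  move=> y ny; apply: contrapT => H; apply: ny; constructor => z Rzy.
  by apply: contrapT => nz; apply: H; exists z.
by exists f; split=> // n; have [] := h n.
Qed.

Lemma path_not_Acc (T : Type) (R : T -> T -> Prop) f :
  (forall n, R (f n.+1) (f n)) -> ~ Acc R (f 0).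
Proof.
move=> h A; move: {-2}(f 0) A (erefl (f 0)) => x A; elim: A f h => {}x _ IH f h e.
by apply: (IH (f 1) _ (fun n => f n.+1)) => //; rewrite -e.
Qed.

Definition dset (c : nat) : set nat := fun m => ent c m <> 0.

(* [child y i j]: the node [j] is a child of the node [i] in the tree of the
   real [y].  The node [0] is a root above all other nodes. *)
Definition tree_spec (x : set nat) (child : set nat -> nat -> nat -> Prop) : Prop :=
  [/\ forall C (en : C -> seq nat) ev y i j,
        sdef en ev (fun _ => x) -> sdef en ev y -> ndef en ev i -> ndef en ev j ->
        arith en ev (fun c => child (y c) (i c) (j c)),
      forall y y' i j, agree j y y' -> child y i j -> child y' i j
    & forall y j, child y 0 j <-> 0 < j].

Definition above (child : set nat -> nat -> nat -> Prop) (y : set nat) (j i : nat) :=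
  child y i j.

Section TreeOfApprox.
Context (x : set nat) (D : approx) (aD : arithD D) (mD : monoD D) (lD : localD D).

(** The nodes are finite approximations to the Skolem data [G]; each one verifies the instances up
    to the length of its predecessor, so that an infinite path converges to a full [G]. *)
Definition node (y : set nat) (c c' : nat) : Prop :=
  size (decode c) < size (decode c') /\
  ((forall i, i < size (decode c) -> ent c i = ent c' i) /\
   D (size (decode c)) (size (decode c')) [::] (dset c') [:: y; x]).

(** Codes are shifted by one to make room for the root. *)
Definition node_child (y : set nat) (i j : nat) : Prop :=
  (i = 0 /\ 0 < j) \/ (exists a b, i = a.+1 /\ (j = b.+1 /\ node y a b)).

Lemma node_child_spec : tree_spec x node_child.
Proof.
split.
- move=> C en ev y i j hx hy hi hj; rewrite /node_child /node; ar.
  apply: aD; [ar|ar| |rewrite /dset; ar|].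
    by move=> k; exists AZero => c; rewrite nth_nil.
  case=> [|[|k]] /=; [ar|ar|exists (ANot (AEq AZero AZero)) => c].
  by rewrite nth_nil; split=> // /(_ erefl).
- move=> y y' i j ag [?|[a [b [ei [ej [lt [pr Dab]]]]]]]; [by left|right].
  exists a, b; do 4!split=> //; apply: lD Dab => // -[|[|k]] //= m lm.
  by apply: ag; have := size_decode_le b; lia.
- move=> y j; split=> [[[]//|[a [b []//]]]|]; by left.
Qed.

Lemma node_child_wf y :
  Acc (above node_child y) 0 <-> ~ exists G, forall l, exists l', D l l' [::] G [:: y; x].
Proof.
split=> [A [G /choice[F hF]]|nG].
  (* Each length is at least the bound [F] needs for the previous one, so the initial segments of
     [G] of these lengths form an infinite path. *)
  pose l := fix l n := if n is k.+1 then maxn (l k).+1 (F (l k)) else 0.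
  have /choice[cd hcd] : forall n, exists c, decode c = mkseq (fun i => nat_of_bool `[< G i >]) n.
    by move=> n; apply: decode_surj.
  have dG n m : m < n -> dset (cd n) m <-> G m.
    move=> lm; rewrite /dset /ent hcd nth_mkseq //.
    by case: asboolP => g; split=> // /(_ erefl).
  have A1 : Acc (above node_child y) (cd (l 0)).+1 by apply: (Acc_inv A); left.
  apply: (path_not_Acc (f := fun n => (cd (l n)).+1) _ A1) => n.
  right; exists (cd (l n)), (cd (l n.+1)); do 2!split=> //.
  rewrite /node !hcd !size_mkseq; split; first by rewrite /=; lia.
  split=> [i hi|].
    by rewrite /ent !hcd !nth_mkseq //=; lia.
  have Dl : D (l n) (l n.+1) [::] G [:: y; x].
    by apply: mD (hF (l n)) (leqnn _) _; rewrite /=; lia.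
  by apply: lD Dl => [m lm|//]; rewrite dG.
apply: contrapT => nA; apply: nG; have [f [f0 fp]] := not_Acc_path nA.
have fS n : f n.+1 = (f n.+1).-1.+1.
  have := fp n; rewrite /above => -[[_]|[a [b [_ [-> _]]]]//].
  by case: (f n.+1).
pose g n := (f n.+1).-1.
have gn n : node y (g n) (g n.+1).
  have := fp n.+1; rewrite /above => -[[]|[a [b [ea [eb nab]]]]].
    by rewrite fS.
  by rewrite /g ea eb.
pose s n := size (decode (g n)).
have sn n : n <= s n.
  by elim: n => // n IH; have [] := gn n; rewrite -/(s n) -/(s n.+1); lia.
have gext n k m : m < s n -> ent (g n) m = ent (g (n + k)) m.
  elim: k => [|k IH] lm; first by rewrite addn0.
  rewrite IH // addnS; have [_ [-> //]] := gn (n + k).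
  rewrite -/(s (n + k)); apply: (leq_trans lm).
  elim: k {IH} => [|k IH]; first by rewrite addn0.
  by apply: (leq_trans IH); rewrite addnS; have [] := gn (n + k);
    rewrite -/(s (n + k)) -/(s (n + k).+1); lia.
(* The limit of the path: [g m.+1] has length above [m], so it decides the bit [m]. *)
exists (fun m => dset (g m.+1) m) => l; exists (s l.+1).
have [_ [_ d]] := gn l.
suff : D (s l) (s l.+1) [::] (fun m => dset (g m.+1) m) [:: y; x].
  by move=> /mD; apply; [exact: sn|exact: leqnn].
apply: lD d => [m lm|//]; rewrite /dset.
suff -> : ent (g l.+1) m = ent (g m.+1) m by [].
by rewrite (gext _ m.+1 m lm) addnC -(gext _ _ _ (sn m.+1)).
Qed.

End TreeOfApprox.

(** The tree of [y] searches for a counterexample [z] to membership in [A], together with Skolem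
    data certifying it. *)
Lemma tree_repr x A : Pi11 x A ->
  exists child, tree_spec x child /\ forall y, A y <-> Acc (above child y) 0.
Proof.
move=> [f hf]; have [D [aD mD lD sD]] := NF_exset (NF_formula f).2.
exists (node_child x D); split; first exact: node_child_spec.
move=> y; rewrite node_child_wf // -sD hf; split=> [h [z]|h z]; first exact.
by apply: contrapT => nz; apply: h; exists z.
Qed.

(** * Ranks of tree nodes *)

(** A node together with its real, so that ranks in the trees of different reals are compared in one
    relation. *)
Definition point : Type := set nat * nat.

Section Rank.
Context (child : set nat -> nat -> nat -> Prop).
Implicit Types p q r : point.

Definition step q p := q.1 = p.1 /\ child p.1 p.2 q.2.

Notation wf := (Acc step).

Lemma wf_above y n : wf (y, n) <-> Acc (above child y) n.
Proof.
split.
  suff h p : wf p -> forall m, p = (y, m) -> Acc (above child y) m by move=> /h; apply.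
  elim=> {}p _ IH m e; constructor => k cmk; apply: (IH (y, k)) => //.
  by rewrite e; split.
elim=> {}n _ IH; constructor => -[z m] [/= -> cnm]; exact: IH.
Qed.

(** Comparing ranks by simulations keeps the comparison analytic. *)
Definition sim (R : point -> point -> Prop) : Prop :=
  forall p q, R p q -> forall p', step p' p -> exists q', step q' q /\ R p' q'.

(* The rank of [p] is at most that of [q], for well-founded [q]. *)
Definition rle p q : Prop := exists R, sim R /\ R p q.

Definition rlt p q : Prop := exists q', step q' q /\ rle p q'.

Lemma rleP p q : rle p q <-> forall p', step p' p -> exists q', step q' q /\ rle p' q'.
Proof.
split=> [[R [sR Rpq]] p' pp'|h].
  by have [q' [qq' Rpq']] := sR _ _ Rpq _ pp'; exists q'; split=> //; exists R.
exists (fun a b => rle a b \/ (a = p /\ b = q)); split; last by right.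
move=> a b [[R [sR Rab]]|[-> ->]] a' aa'.
  by have [b' [bb' Rab']] := sR _ _ Rab _ aa'; exists b'; split=> //; left; exists R.
by have [b' [? ?]] := h _ aa'; exists b'; split=> //; left.
Qed.

Lemma rle_refl p : rle p p.
Proof. by exists eq; split=> // a _ <- a' ?; exists a'. Qed.

Lemma rle_trans p q r : rle p q -> rle q r -> rle p r.
Proof.
move=> [R [sR Rpq]] [S [sS Sqr]].
exists (fun a c => exists b, R a b /\ S b c); split; last by exists q.
move=> a c [b [Rab Sbc]] a' aa'.
have [b' [bb' Rab']] := sR _ _ Rab _ aa'; have [c' [cc' Sbc']] := sS _ _ Sbc _ bb'.
by exists c'; split=> //; exists b'.
Qed.

Lemma rle_rlt_trans p q r : rle p q -> rlt q r -> rlt p r.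
Proof. by move=> pq [r' [? qr']]; exists r'; split=> //; apply: rle_trans qr'. Qed.

Lemma rlt_rle_trans p q r : rlt p q -> rle q r -> rlt p r.
Proof.
move=> [q' [qq' pq']] /rleP/(_ _ qq')[r' [? ?]].
by exists r'; split=> //; apply: rle_trans pq' _.
Qed.

Lemma step_rlt p q : step p q -> rlt p q.
Proof. by exists p; split=> //; apply: rle_refl. Qed.

Lemma step_rle p q : wf q -> step p q -> rle p q.
Proof.
move=> A; elim: A p => {}q _ IH p pq; apply/rleP => p' pp'.
by exists p; split=> //; apply: IH.
Qed.

Lemma rlt_rle p q : wf q -> rlt p q -> rle p q.
Proof. by move=> wq [q' [qq' pq']]; apply: rle_trans pq' _; apply: step_rle. Qed.

Lemma rle_wf p q : rle p q -> wf q -> wf p.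
Proof.
move=> pq wq; elim: wq p pq => {}q _ IH p /rleP pq.
by constructor => p' /pq[q' [qq' ?]]; apply: IH qq' _ _.
Qed.

Lemma rlt_wf p q : rlt p q -> wf q -> wf p.
Proof. by move=> pq wq; apply: rle_wf (rlt_rle wq pq) wq. Qed.

Lemma rle_total p q : wf p -> ~ rle p q -> rlt q p.
Proof.
move=> wp; elim: wp q => {}p _ IH q npq; apply: contrapT => nqp; apply: npq.
apply/rleP => p' pp'; apply: contrapT => H; apply: nqp.
exists p'; split=> //; apply/rleP => q' qq'; apply: IH => // pq'.
by apply: H; exists q'.
Qed.

Lemma Acc_rlt q : wf q -> Acc rlt q.
Proof.
elim=> {}q _ IH; constructor => p [q' [/IH A pq']].
by constructor => r /rlt_rle_trans/(_ pq'); apply: Acc_inv.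
Qed.

Lemma rlt_irr p : wf p -> ~ rlt p p.
Proof. by move=> /Acc_rlt A pp; apply: (path_not_Acc (f := fun _ => p)) A. Qed.

Lemma rle_rltF p q : wf p -> rle p q -> ~ rlt q p.
Proof. by move=> wp pq qp; apply: (rlt_irr wp); apply: rle_rlt_trans qp. Qed.

(** An ordinal is represented by the set of all nodes, in the trees of all reals, of smaller rank;
    equal ordinals are then equal sets. *)
Definition rank : Type := set point.

Definition rk p : rank := [set q | rlt q p].

Lemma rk_eq p q : wf p -> wf q -> rk p = rk q <-> rle p q /\ rle q p.
Proof.
move=> wp wq; split=> [e|[pq qp]].
  split; apply: contrapT => /rle_total h.
    by apply: (rlt_irr wq); suff : rk q q by []; rewrite -e; apply: h.
  by apply: (rlt_irr wp); suff : rk p p by []; rewrite e; apply: h.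
by apply/funext => r; apply/propext; split=> h; apply: rlt_rle_trans h _.
Qed.

Definition lto (o o' : rank) : Prop := exists2 q, o' q & o = rk q.
Definition valid (o : rank) : Prop := exists2 p, wf p & o = rk p.

Lemma lto_rk p q : wf p -> wf q -> lto (rk p) (rk q) <-> rlt p q.
Proof.
move=> wp wq; split=> [[r rq e]|pq]; last by exists p.
have wr := rlt_wf rq wq; have [pr _] := (rk_eq wp wr).1 e.
exact: rle_rlt_trans pr rq.
Qed.

Lemma Acc_lto o : valid o -> Acc lto o.
Proof.
move=> [p wp ->]; elim: (Acc_rlt wp) => {wp}p _ IH.
by constructor => _ [q qp ->]; apply: IH.
Qed.

(** Induction on [p]: a node of smaller rank lies below a child of [p], and either has the rank of
    that child or is strictly below it. Thus the ordinals below a rank are named by the nodes of one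
    tree, which are countably many. *)
Lemma lto_realized o p : wf p -> lto o (rk p) -> exists n, o = rk (p.1, n).
Proof.
move=> wp [q qp ->]; elim: wp q qp => {}p A IH q [p' [pp' qp']].
have wp' : wf p' by apply: A.
have e : p' = (p.1, p'.2) by case: p' pp' {wp' qp'} => a b [/= ->].
have [pq|/(rle_total wp') h] := pselect (rle p' q).
  exists p'.2; rewrite -e; apply/(rk_eq (rle_wf qp' wp') wp').
  by split; [exact: qp'|exact: pq].
by have [n ->] := IH _ pp' _ h; exists n; rewrite e.
Qed.

(** Between two fixed trees a simulation is a relation on numbers, hence coded by a real. *)
Lemma rle_coded y z i j : rle (z, i) (y, j) <->
  exists S : set nat,
    (forall a b, S (cpair a b) -> forall a', child z a a' ->
       exists b', child y b b' /\ S (cpair a' b')) /\ S (cpair i j).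
Proof.
split=> [h|[S [h Sij]]].
  exists (fun m => exists a b, m = cpair a b /\ rle (z, a) (y, b)).
  split; last by exists i, j.
  move=> _ _ [a [b [/cpair_inj[-> ->] /rleP ab]]] a' za.
  have [|[y' b'] [[/= -> yb] ab']] := ab (z, a'); first by split.
  by exists b'; split=> //; exists a', b'.
exists (fun p q => p.1 = z /\ (q.1 = y /\ S (cpair p.2 q.2))); split=> //.
move=> [_ a] [_ b] /= [-> [-> Sab]] [z' a'] [/= -> za].
by have [b' [? ?]] := h _ _ Sab _ za; exists (y, b').
Qed.

End Rank.

(** * Analytic and co-analytic predicates *)

Definition S11 (C : Type) (en : C -> seq nat) (ev : C -> seq (set nat)) (P : C -> Prop) :=
  exists Q : C -> set nat -> Prop,
    arith (ens en) (evs ev) (fun p => Q p.1 p.2) /\ forall c, P c <-> exists Z, Q c Z.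

Definition P11 (C : Type) (en : C -> seq nat) (ev : C -> seq (set nat)) (P : C -> Prop) :=
  S11 en ev (fun c => ~ P c).

Section ProjectiveClosure.
Context (C : Type) (en : C -> seq nat) (ev : C -> seq (set nat)).
Implicit Types (P Q : C -> Prop).

Lemma S11_eqv P Q : (forall c, P c <-> Q c) -> S11 en ev Q -> S11 en ev P.
Proof. by move=> h [R [aR hR]]; exists R; split=> // c; rewrite h. Qed.

Lemma P11_eqv P Q : (forall c, P c <-> Q c) -> P11 en ev Q -> P11 en ev P.
Proof. by move=> h; apply: S11_eqv => c; rewrite h. Qed.

Lemma S11_arith P : arith en ev P -> S11 en ev P.
Proof.
move=> aP; exists (fun c _ => P c); split; first exact: arith_wks.
by move=> c; split=> [h|[]//]; exists set0.
Qed.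

Lemma P11_arith P : arith en ev P -> P11 en ev P.
Proof. by move=> h; apply: S11_arith; apply: arith_not. Qed.

Lemma S11_exset (P : C -> set nat -> Prop) :
  S11 (ens en) (evs ev) (fun p => P p.1 p.2) -> S11 en ev (fun c => exists Z, P c Z).
Proof.
move=> [Q [aQ hQ]]; exists (fun c Z => Q (c, part 0 Z) (part 1 Z)); split.
  apply: (arith_pull (h := fun p : C * set nat => ((p.1, part 0 p.2), part 1 p.2))) aQ _ _.
    by move=> i; exists (AVar i).
  move=> [|[|i]] /=; [ar|ar|by exists (AMem (AVar 0) i.+1)].
move=> c; split=> [[Z /(hQ (c, Z))[W h]]|[Z h]].
  by exists (join Z W); rewrite part0_join part1_join.
by exists (part 0 Z); apply/(hQ (c, part 0 Z)); exists (part 1 Z).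
Qed.

Lemma S11_ex (P : C -> nat -> Prop) :
  S11 (enn en) (evn ev) (fun p => P p.1 p.2) -> S11 en ev (fun c => exists n, P c n).
Proof.
move=> [Q [aQ hQ]]; exists (fun c Z => exists n, Q (c, n) Z); split.
  apply: arith_ex.
  apply: (arith_pull (h := fun p : C * set nat * nat => ((p.1.1, p.2), p.1.2))) aQ _ _.
    by move=> i; exists (AVar i).
  by move=> i; exists (AMem (AVar 0) i).
move=> c; split=> [[n /(hQ (c, n))[Z h]]|[Z [n h]]]; first by exists Z, n.
by exists n; apply/(hQ (c, n)); exists Z.
Qed.

Lemma S11_all (P : C -> nat -> Prop) :
  S11 (enn en) (evn ev) (fun p => P p.1 p.2) -> S11 en ev (fun c => forall n, P c n).
Proof.
move=> [Q [aQ hQ]]; exists (fun c Z => forall n, Q (c, n) (column n Z)); split.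
  apply: arith_all.
  apply: (arith_pull (h := fun p : C * set nat * nat => ((p.1.1, p.2), column p.2 p.1.2)))
    aQ _ _.
    by move=> i; exists (AVar i).
  by move=> [|i] /=; [ar|exists (AMem (AVar 0) i.+1)].
move=> c; split=> [h|[Z h] n].
  have /choice[Zs hZ] : forall n, exists Z, Q (c, n) Z by move=> n; apply/hQ/h.
  by exists (columns Zs) => n; rewrite column_columns.
by apply/(hQ (c, n)); exists (column n Z).
Qed.

End ProjectiveClosure.

Section ProjectiveClosure2.
Context (C : Type) (en : C -> seq nat) (ev : C -> seq (set nat)).
Implicit Types (P Q : C -> Prop).

Lemma S11_and P Q : S11 en ev P -> S11 en ev Q -> S11 en ev (fun c => P c /\ Q c).
Proof.
move=> [R [aR hR]] [S [aS hS]].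
exists (fun c Z => R c (part 0 Z) /\ S c (part 1 Z)); split.
  apply: arith_and.
    apply: (arith_pull (h := fun p : C * set nat => (p.1, part 0 p.2))) aR _ _ => i.
      by exists (AVar i).
    by case: i => [|i] /=; [ar|exists (AMem (AVar 0) i.+1)].
  apply: (arith_pull (h := fun p : C * set nat => (p.1, part 1 p.2))) aS _ _ => i.
    by exists (AVar i).
  by case: i => [|i] /=; [ar|exists (AMem (AVar 0) i.+1)].
move=> c; rewrite hR hS; split=> [[[Z hZ] [W hW]]|[Z [? ?]]].
  by exists (join Z W); rewrite part0_join part1_join.
by split; [exists (part 0 Z)|exists (part 1 Z)].
Qed.

Lemma S11_or P Q : S11 en ev P -> S11 en ev Q -> S11 en ev (fun c => P c \/ Q c).
Proof.
move=> [R [aR hR]] [S [aS hS]].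
exists (fun c Z => R c Z \/ S c Z); split; first exact: arith_or.
move=> c; rewrite hR hS; split=> [[[Z hZ]|[Z hZ]]|[Z [?|?]]]; try by exists Z; auto.
  by left; exists Z.
by right; exists Z.
Qed.

Lemma P11_and P Q : P11 en ev P -> P11 en ev Q -> P11 en ev (fun c => P c /\ Q c).
Proof. by move=> hP hQ; apply: S11_eqv (S11_or hP hQ) => c; rewrite not_andE. Qed.

Lemma P11_imp P Q : S11 en ev P -> P11 en ev Q -> P11 en ev (fun c => P c -> Q c).
Proof. by move=> hP hQ; apply: S11_eqv (S11_and hP hQ) => c; rewrite not_implyE. Qed.

Lemma P11_not P : S11 en ev P -> P11 en ev (fun c => ~ P c).
Proof. by apply: S11_eqv => c; split=> [/contrapT|]; tauto. Qed.

Lemma P11_allset (P : C -> set nat -> Prop) :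
  P11 (ens en) (evs ev) (fun p => P p.1 p.2) -> P11 en ev (fun c => forall Z, P c Z).
Proof.
move=> h; apply: S11_eqv (S11_exset (P := fun c Z => ~ P c Z) h) => c.
by rewrite -existsNP.
Qed.

End ProjectiveClosure2.

Lemma Pi11_of_P11 x A :
  P11 (fun _ : set nat => [::]) (fun y => [:: y; x]) A -> Pi11 x A.
Proof.
move=> [Q [[f hf] hQ]]; exists (ANot f) => y /=; split=> [Ay z /(hf (y, z)) Qyz|h].
  by apply: (hQ y).2 Ay; exists z.
by apply: contrapT => /hQ[z /(hf (y, z))]; apply: h.
Qed.

Lemma P11_of_Pi11 x A C (en : C -> seq nat) ev (y : C -> set nat) :
  Pi11 x A -> sdef en ev (fun _ => x) -> sdef en ev y -> P11 en ev (fun c => A (y c)).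
Proof.
move=> [f hf] hx hy; exists (fun c z => ~ asat [::] [:: z; y c; x] f); split; last first.
  by move=> c; rewrite hf -existsNP.
apply: arith_not.
have ha : arith (fun _ : set nat * set nat => [::]) (fun p => [:: p.2; p.1; x])
    (fun p => asat [::] [:: p.2; p.1; x] f) by exists f.
apply: (arith_pull (h := fun p : C * set nat => (y p.1, p.2))) ha _ _.
  by move=> i; exists AZero => c; rewrite nth_nil.
move=> [|[|[|i]]] /=; [ar|ar|ar|exists (ANot (AEq AZero AZero)) => c].
by rewrite nth_nil; split=> // /(_ erefl).
Qed.

(** * Uniformization *)

Section Lexicographic.
Context (child : set nat -> nat -> nat -> Prop).

Notation rle := (rle child).
Notation rlt := (rlt child).
Notation wf := (Acc (step child)).

Definition eqat (j : nat) (z y : set nat) : Prop :=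
  (rle (z, j) (y, j) /\ rle (y, j) (z, j)) /\ (z j <-> y j).

Definition eqlex (n : nat) (z y : set nat) : Prop := forall j, j < n -> eqat j z y.

(** Ranks are compared first, then bits, with absence before presence. In the second case [rle]
    stands for equality of ranks, as a strict inequality falls under the first. *)
Definition ltat (n : nat) (z y : set nat) : Prop :=
  rlt (z, n) (y, n) \/ (rle (z, n) (y, n) /\ (~ z n /\ y n)).

Lemma eqat_sym j z y : eqat j z y -> eqat j y z.
Proof. by move=> [[? ?] e]; split; [split|symmetry]. Qed.

Lemma ltat_eqat n u z y : ltat n u z -> eqat n z y -> ltat n u y.
Proof.
move=> [h|[h [nu zn]]] [[zy yz] e]; [left|right].
  exact: rlt_rle_trans h zy.
by split; [apply: rle_trans h zy|rewrite -e].
Qed.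

Lemma ltat_total n z y : wf (z, n) -> wf (y, n) ->
  ~ ltat n z y -> ~ ltat n y z -> eqat n z y.
Proof.
move=> wz wy nzy nyz.
have zy : rle (z, n) (y, n) by apply: contrapT => /(rle_total wz) h; apply: nyz; left.
have yz : rle (y, n) (z, n) by apply: contrapT => /(rle_total wy) h; apply: nzy; left.
split=> //; split=> h; apply: contrapT => nh; [apply: nyz|apply: nzy]; by right.
Qed.

(** The least rank exists by well-foundedness; among the elements attaining it, one that omits [n]
    is preferred. *)
Lemma ltat_min n (G : set nat -> Prop) :
  (forall u, G u -> wf (u, n)) -> (exists u, G u) ->
  exists u, G u /\ forall u', G u' -> ~ ltat n u' u.
Proof.
move=> wG [u0 G0].
have [u1 [G1 m1]] : exists u, G u /\ forall u', G u' -> ~ rlt (u', n) (u, n).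
  suff h p : Acc rlt p -> forall u, G u -> p = (u, n) ->
      exists u, G u /\ forall u', G u' -> ~ rlt (u', n) (u, n).
    exact: h (Acc_rlt (wG _ G0)) _ G0 erefl.
  elim=> {}p _ IH u Gu e; have [[u' [Gu' lt]]|H] :=
    pselect (exists u', G u' /\ rlt (u', n) (u, n)).
    by apply: (IH (u', n)) Gu' erefl; rewrite e.
  by exists u; split=> // u' Gu' lt; apply: H; exists u'.
have [[u2 [G2 [le2 n2]]]|H] := pselect (exists u, G u /\ (rle (u, n) (u1, n) /\ ~ u n)).
  exists u2; split=> // u' Gu' [lt|[_ []]//].
  by apply: m1 Gu' (rlt_rle_trans lt le2).
exists u1; split=> // u' Gu' [/m1|[le [nu _]]]; first exact.
by apply: H; exists u'.
Qed.

(* The elements of [F] whose first [n] pairs (rank of the node j, membership of j)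
   are lexicographically least. *)
Fixpoint leftmost (F : set nat -> Prop) (n : nat) : set nat -> Prop :=
  if n is m.+1 then
    fun u => leftmost F m u /\ forall u', leftmost F m u' -> ~ ltat m u' u
  else F.

Lemma leftmost_le F n m u : m <= n -> leftmost F n u -> leftmost F m u.
Proof.
elim: n => [|n IH]; first by rewrite leqn0 => /eqP->.
by rewrite leq_eqVlt => /orP[/eqP->//|]; rewrite ltnS => /IH h [/h].
Qed.

Lemma leftmost_eqlex F n z y : F z -> leftmost F n y -> eqlex n z y -> leftmost F n z.
Proof.
move=> Fz; elim: n => //= n IH [ly my] e; split.
  by apply: IH => // j lj; apply: e; lia.
by move=> u' lu' /ltat_eqat/(_ (e n (ltnSn n))); apply: my.
Qed.

Section WellFounded.
Context (F : set nat -> Prop) (wF : forall u n, F u -> wf (u, n)).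

Lemma leftmost_ex n : (exists u, F u) -> exists u, leftmost F n u.
Proof.
move=> Fne; elim: n => // n IH; apply: ltat_min IH => u /(leftmost_le (leq0n n)) Fu.
exact: wF.
Qed.

Lemma eqlex_leftmost n z y : leftmost F n z -> leftmost F n y -> eqlex n z y.
Proof.
move=> lz ly j lj; have [z0 zj] := leftmost_le lj lz; have [y0 yj] := leftmost_le lj ly.
by apply: ltat_total; [apply/wF/(leftmost_le (leq0n j))..|apply: yj|apply: zj].
Qed.

Lemma leftmost_min n z y j : F z -> leftmost F n y -> j < n -> eqlex j z y -> ~ ltat j z y.
Proof.
move=> Fz ly lj e; have [yj] := leftmost_le lj ly; apply.
exact: leftmost_eqlex Fz yj e.
Qed.

End WellFounded.
End Lexicographic.

Ltac ar_child :=
  match goal with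
  | h : tree_spec _ ?ch |- arith _ _ (fun _ => ?ch _ _ _) => case: (h) => + _ _; apply
  end.

Section LexDefinable.
Context (x : set nat) (child : set nat -> nat -> nat -> Prop) (tC : tree_spec x child).
Context (C : Type) (en : C -> seq nat) (ev : C -> seq (set nat)).
Implicit Types (y z : C -> set nat).

Lemma S11_rle y z i j :
  sdef en ev (fun _ => x) -> sdef en ev y -> sdef en ev z -> ndef en ev i -> ndef en ev j ->
  S11 en ev (fun c => rle child (z c, i c) (y c, j c)).
Proof.
move=> hx hy hz hi hj; apply: S11_eqv; first by move=> c; apply: rle_coded.
by apply: S11_exset; apply: S11_arith; do ?[ar_child|ar_step].
Qed.

End LexDefinable.

Section LexDefinable2.
Context (x : set nat) (child : set nat -> nat -> nat -> Prop) (tC : tree_spec x child).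
Context (C : Type) (en : C -> seq nat) (ev : C -> seq (set nat)).
Implicit Types (y z : C -> set nat).

Lemma S11_rlt y z i j :
  sdef en ev (fun _ => x) -> sdef en ev y -> sdef en ev z -> ndef en ev i -> ndef en ev j ->
  S11 en ev (fun c => rlt child (z c, i c) (y c, j c)).
Proof.
move=> hx hy hz hi hj; apply: S11_eqv (fun c => exists j', child (y c) (j c) j' /\
    rle child (z c, i c) (y c, j')) _ _.
  move=> c; split=> [[[y' j'] [[/= -> cj] h]]|[j' [cj h]]]; first by exists j'.
  by exists (y c, j').
apply: S11_ex; apply: S11_and; first by apply: S11_arith; do ?[ar_child|ar_step].
by apply: (S11_rle tC); ar.
Qed.

End LexDefinable2.

Section LexDefinable3.
Context (x : set nat) (child : set nat -> nat -> nat -> Prop) (tC : tree_spec x child).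
Context (C : Type) (en : C -> seq nat) (ev : C -> seq (set nat)).
Implicit Types (y z : C -> set nat).

Lemma S11_eqlex y z n :
  sdef en ev (fun _ => x) -> sdef en ev y -> sdef en ev z -> ndef en ev n ->
  S11 en ev (fun c => eqlex child (n c) (z c) (y c)).
Proof.
move=> hx hy hz hn; rewrite /eqlex /eqat; apply: S11_all.
apply: (S11_eqv (Q := fun p => ~ p.2 < n p.1 \/ ((rle child (z p.1, p.2) (y p.1, p.2) /\
    rle child (y p.1, p.2) (z p.1, p.2)) /\ (z p.1 p.2 <-> y p.1 p.2)))).
  by move=> p /=; case: (p.2 < n p.1); split; [right; auto|case|left|]; auto.
apply: S11_or; first by apply: S11_arith; ar.
apply: S11_and; last by apply: S11_arith; ar.
by apply: S11_and; apply: (S11_rle tC); ar.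
Qed.

Lemma S11_ltat y z n :
  sdef en ev (fun _ => x) -> sdef en ev y -> sdef en ev z -> ndef en ev n ->
  S11 en ev (fun c => ltat child (n c) (z c) (y c)).
Proof.
move=> hx hy hz hn; rewrite /ltat; apply: S11_or; first by apply: (S11_rlt tC).
apply: S11_and; first by apply: (S11_rle tC).
by apply: S11_arith; ar.
Qed.

End LexDefinable3.

Section Uniformization.
Context (x : set nat) (child : set nat -> nat -> nat -> Prop) (tC : tree_spec x child).

Notation wf := (Acc (step child)).

Lemma root_wf y : Acc (above child y) 0 -> forall n, wf (y, n).
Proof.
have [_ _ root] := tC; move=> /wf_above w0 [//|n].
by apply: (Acc_inv w0); split=> //; apply/root.
Qed.

(* The ranks in the tree of the coordinatewise limit [v] of the leftmost elements are
   bounded by their limit ranks, because children are decided by finitely many bits. *)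
Lemma leftmost_limit (F : set nat -> Prop) :
  (forall u n, F u -> wf (u, n)) -> (exists u, F u) ->
  exists v, [/\ forall n, wf (v, n),
    forall n, exists u, F u /\ agree n u v & F v -> forall n, leftmost child F n v].
Proof.
move=> wF Fne; have /choice[u hu] n := leftmost_ex wF n Fne.
have Fu n : F (u n) by exact: leftmost_le (leq0n n) (hu n).
pose v : set nat := fun n => u n.+1 n.
have uu m n : m < n -> eqat child m (u n) (u m.+1).
  move=> lmn; apply: (eqlex_leftmost wF (n := m.+1)) => //.
  exact: leftmost_le lmn (hu n).
have uv n : agree n (u n) v by move=> m /uu[_ ->].
have [_ modulus _] := tC.
(* The limit ranks, those of node [i] in the tree of [u i.+1], decrease along the tree of [v]: a
   child relation of [v] already holds for some [u N], where the ranks below [N] have settled. *)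
have dec i j : child v i j -> rlt child (u j.+1, j) (u i.+1, i).
  set N := (maxn i j).+1 => cij; have Ni : i < N by lia.
  have Nj : j < N by lia.
  have cN : child (u N) i j by apply: modulus cij => m lm; rewrite uv //; lia.
  have [[_ e1] _] := uu _ _ Nj; have [[e2 _] _] := uu _ _ Ni.
  apply: rle_rlt_trans e1 _; apply: rlt_rle_trans e2.
  by apply: step_rlt; split.
have le i : rle child (v, i) (u i.+1, i).
  suff h p : Acc (rlt child) p -> forall i, p = (u i.+1, i) -> rle child (v, i) p.
    exact: h (Acc_rlt (wF _ _ (Fu _))) _ erefl.
  elim=> {}p _ IH k e; apply/rleP => -[v' j] [/= -> ckj].
  have := dec _ _ ckj => -[q [sq hq]]; exists q; rewrite e; split=> //.
  by apply: rle_trans hq; apply: IH => //; rewrite e; apply: dec.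
have wv n : wf (v, n) by apply: rle_wf (le n) _; apply: wF.
exists v; split=> //; first by move=> n; exists (u n).
(* Since the ranks of [v] are at most the limit ranks, an element below [v] at place [n] would also
   be below the leftmost [u n.+1]. *)
move=> Fv; elim=> //= n IH; split=> // u' lu'.
have eu : eqlex child n u' v.
  exact: eqlex_leftmost lu' IH.
move=> lt; have [_ /(_ u' lu')] := hu n.+1; apply.
case: lt => [lt|[lt [nu vn]]]; [left|right].
  exact: rlt_rle_trans lt (le n).
by split; [apply: rle_trans lt (le n)|].
Qed.

(** The competitor [u] ranges over all reals, which makes the condition co-analytic; one
    lexicographically below a member of a set defined by the tree is itself a member, since its root
    has no larger rank. *)
Definition uniform (A : set nat -> Prop) (v : set nat) : Prop :=
  A v /\ forall u, (forall m, part 0 u m <-> part 0 v m) ->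
    ~ exists n, eqlex child n u v /\ ltat child n u v.

End Uniformization.

(** The Novikov-Kondo-Addison argument: in each fibre of [part 0] the leftmost elements converge to
    a real with a well-founded tree, hence to the least element of the fibre. *)
Lemma uniformization x (A : set (set nat)) : Pi11 x A ->
  exists B : set (set nat), [/\ Pi11 x B, B `<=` A,
    forall v, A v -> exists u, B u /\ part 0 u = part 0 v
  & forall u v, B u -> B v -> part 0 u = part 0 v -> u = v].
Proof.
move=> pA; have [child [tC hA]] := tree_repr pA; have [_ _ root] := tC.
have wA v n : A v -> Acc (step child) (v, n) by move=> /hA/(root_wf tC).
have Alex u v n : A v -> eqlex child n u v -> ltat child n u v -> A u.
  move=> Av e l; apply/hA/wf_above.
  have wv := wA v 0 Av; case: n e l => [_|n e _]; last first.
    by have [[uv _] _] := e 0 isT; apply: rle_wf uv wv.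
  by case=> [/(rlt_wf)/(_ wv)|[/rle_wf/(_ wv)]].
exists (uniform child A); split.
- apply: Pi11_of_P11; rewrite /uniform.
  have hx : sdef (fun _ : set nat => [::]) (fun y => [:: y; x]) (fun _ => x).
    by exists (AMem (AVar 0) 1).
  have hy : sdef (fun _ : set nat => [::]) (fun y => [:: y; x]) id.
    by exists (AMem (AVar 0) 0).
  apply: P11_and; first exact: (P11_of_Pi11 pA hx hy).
  apply: P11_allset; apply: P11_imp; first by apply: S11_arith; ar.
  apply: P11_not; apply: S11_ex; apply: S11_and.
    by apply: (S11_eqlex tC); ar.
  by apply: (S11_ltat tC); ar.
- by move=> v [].
- move=> v0 A0; pose F u := A u /\ part 0 u = part 0 v0.
  have wF u n : F u -> Acc (step child) (u, n) by move=> [/wA].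
  have [|v [wv lim lm]] := leftmost_limit tC wF; first by exists v0.
  have Fv : F v.
    split; first by apply/hA/wf_above.
    apply/funext => m; have [u [[_ <-] ag]] := lim (2 * m + 0).+1.
    by apply/propext; rewrite /part -ag.
  exists v; split; last by case: Fv.
  split; first by case: Fv.
  move=> u /(fun h => funext (fun m => propext (h m))) uv [n [e l]].
  have Fu : F u by split; [apply: Alex e l; case: Fv|rewrite uv; case: Fv].
  exact: leftmost_min Fu (lm Fv n.+1) (ltnSn n) e l.
- move=> u v [Au hu] [Av hv] uv.
  have e n : eqlex child n u v.
    elim: n => // n IH j; rewrite ltnS leq_eqVlt => /orP[/eqP->|]; last exact: IH.
    have sym : eqlex child n v u by move=> k /IH/eqat_sym.
    apply: ltat_total; [exact: wA|exact: wA|move=> l..].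
      by apply: (hv u); [rewrite uv|exists n].
    by apply: (hu v); [rewrite uv|exists n].
  by apply/funext => n; apply/propext; have [_] := e n.+1 n (ltnSn n).
Qed.

(** * Stages of a monotone operator *)

Section Stages.
Context (T : Type) (K : set T -> set T).
Context (K_mono : forall U V, U `<=` V -> K U `<=` K V).

(** The transfinite iteration of [K] generated without ordinals; the union of the empty family is
    the starting point. *)
Inductive stage : set T -> Prop :=
| stage_K U : stage U -> stage (K U)
| stage_union (F : set T -> Prop) :
    (forall U, F U -> stage U) -> stage (fun p => exists2 U, F U & U p).

Lemma stage_incl U : stage U -> U `<=` K U.
Proof.
elim=> [V _ IH|F _ IH p [V FV Vp]]; first exact: K_mono.
by apply: K_mono (IH V FV p Vp) => q Vq; exists V.
Qed.

(** A double induction, as in Zermelo's proof of the well-ordering theorem. *)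
Lemma stage_linear U V : stage U -> stage V -> U `<=` V \/ K V `<=` U.
Proof.
move=> tU; elim: tU V => [U0 tU0 IH|F _ IH] V tV.
  suff [h|h] : V `<=` U0 \/ K U0 `<=` V; [by right; apply: K_mono|by left|].
  elim: tV => [V0 tV0 [h|h]|G _ IHV].
  - have [h'|h'] := IH V0 tV0; last by left.
    by right; apply: K_mono.
  - by right; apply: subset_trans h (stage_incl tV0).
  - have [[W GW h]|nG] := pselect (exists2 W, G W & K U0 `<=` W).
      by right=> p /h Wp; exists W.
    by left=> p [W GW Wp]; have [h|h] := IHV W GW; [apply: h|case: nG; exists W].
have [[W FW h]|nF] := pselect (exists2 W, F W & K V `<=` W).
  by right=> p /h Wp; exists W.
by left=> p [W FW Wp]; have [h|h] := IH W FW V tV; [apply: h|case: nF; exists W].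
Qed.

Definition killed (p : T) : Prop := exists2 U, stage U & U p.

(* [p] appears in the iteration of [K] no later than [q]. *)
Definition stle (p q : T) : Prop := forall U, stage U -> U q -> U p.

Lemma stle_refl p : stle p p. Proof. by []. Qed.

Lemma stle_trans p q r : stle p q -> stle q r -> stle p r.
Proof. by move=> pq qr U tU /(qr U tU)/(pq U tU). Qed.

Lemma killedK : K killed `<=` killed.
Proof. by move=> p Kp; exists (K killed) => //; apply/stage_K/stage_union. Qed.

Lemma stage_sub V U : K V `<=` V -> stage U -> U `<=` V.
Proof.
move=> KV; elim=> [W _ IH|F _ IH p [W FW Wp]]; last exact: IH Wp.
exact: subset_trans (K_mono IH) KV.
Qed.

(** The union [V] of all stages missing [W] is the last such stage: if [K V] missed [W] too, [V]
    would be closed under [K] and contain every stage. The points of [W] in [K V] come first. *)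
Lemma stle_min (W : set T) : (exists2 p, W p & killed p) ->
  exists2 p, W p & forall q, W q -> stle p q.
Proof.
move=> [p0 Wp0 [U0 tU0 U0p0]].
pose F U := stage U /\ forall p, U p -> ~ W p.
pose V : set T := fun p => exists2 U, F U & U p.
have tV : stage V by apply: stage_union => U [].
have nV p : V p -> ~ W p by case=> U [_ h] /h.
have [[p Wp KVp]|H] := pselect (exists2 p, W p & K V p).
  exists p => // q Wq U tU Uq; have [h|] := stage_linear tU tV; last exact.
  by case: (nV q (h _ Uq)).
have KV : K V `<=` V.
  move=> p KVp; exists (K V) => //; split; first exact: stage_K.
  by move=> q KVq Wq; apply: H; exists q.
by case: (nV p0 (stage_sub KV tU0 U0p0)).
Qed.

(** The points strictly earlier than [q] form the last stage [B] without [q], and [q] enters at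
    [K B]. This recursion for the comparison of stages is what a table has to satisfy. *)
Lemma stleP p q : killed q -> stle p q <-> K (fun p' => ~ stle q p') p.
Proof.
move=> [U0 tU0 U0q].
have [r -> mr] : exists2 r, r = q & forall s, s = q -> stle r s.
  by apply: stle_min; exists q => //; exists U0.
pose F U := stage U /\ ~ U q.
pose B : set T := fun p => exists2 U, F U & U p.
have tB : stage B by apply: stage_union => U [].
have nBq : ~ B q by case=> U [].
have eB : B = (fun p' => ~ stle q p').
  apply/funext => p'; apply/propext; split=> [[U [tU nUq] Up'] /(_ U tU Up')//|nst].
  apply: contrapT => nB; apply: nst => U tU Up'.
  by apply: contrapT => nUq; apply: nB; exists U.
have KBq : K B q.
  apply: contrapT => nKB; apply: nBq.
  by apply: stage_sub tU0 _ U0q => p' KBp'; exists (K B) => //; split=> //; apply: stage_K.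
rewrite -eB; split=> [/(_ _ (stage_K tB) KBq)//|KBp U tU Uq].
by have [h|] := stage_linear tU tB; [case: nBq; apply: h|apply].
Qed.

Section Uniqueness.
Context (T' : Type) (w : T' -> T) (G : set T') (K' : set T' -> set T').
Context (K'_mono : forall U V c, (forall d, G d -> U d -> V d) -> K' U c -> K' V c).
Context (KK' : forall U c, G c -> K U (w c) <-> K' (fun d => U (w d)) c).
Context (allK : forall c, G c -> killed (w c)).
Context (L : T' -> T' -> Prop).
Context (LP : forall c d, G c -> G d -> L c d <-> K' (fun e => ~ L d e) c).

(** The recursion of [stleP] has only one solution. At a code [c] of least stage where [L] errs,
    [L c d] is settled by the codes killed strictly before [c], and then [L d c] by the values
    [L c e]. *)
Lemma stle_unique c d : G c -> G d -> L c d <-> stle (w c) (w d).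
Proof.
suff ok c' : G c' -> forall d', G d' ->
    (L c' d' <-> stle (w c') (w d')) /\ (L d' c' <-> stle (w d') (w c')).
  by move=> Gc Gd; have [] := ok c Gc d Gd.
move: c' => {c d}; apply: contrapT => /existsNP[c0 /not_implyP[Gc0 bad0]].
pose ok c := forall d', G d' ->
    (L c d' <-> stle (w c) (w d')) /\ (L d' c <-> stle (w d') (w c)).
have [|_ [c Gc [bad ->]] mc] := @stle_min (fun p => exists2 c, G c & ~ ok c /\ p = w c).
  by exists (w c0); [exists c0|apply: allK].
have IH d : G d -> ~ stle (w c) (w d) -> ok d.
  by move=> Gd nst; apply: contrapT => nok; apply: nst; apply: mc; exists d.
have one d : G d -> L c d <-> stle (w c) (w d).
  move=> Gd; split=> [h|cd].
    by apply: contrapT => nst; have [_ [/(_ h)]] := IH d Gd nst c Gc.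
  apply/LP => //; have /(stleP _ (allK Gc))/(KK' _ Gc) := stle_refl (p := w c).
  apply: K'_mono => e Ge nce; have [_ [Lde _]] := IH e Ge nce d Gd.
  by move=> /Lde de; apply: nce; apply: stle_trans cd de.
apply: bad => d Gd; split; first exact: one.
rewrite LP // stleP; last exact: allK.
rewrite KK' //; split; apply: K'_mono => e Ge; by rewrite one.
Qed.

End Uniqueness.
End Stages.

(** * The killing process *)

Lemma infinite_setP_nat (A : set nat) : infinite_set A <-> forall k, exists2 m, k <= m & A m.
Proof.
split=> [iA k|h /finite_seqP[s eA]].
  apply: contrapT => H; apply: iA; apply: (@sub_finite_set _ A `I_k); last exact: finite_II.
  by move=> m Am /=; rewrite ltnNge; apply/negP => km; apply: H; exists m.
have [m lm] := h (\max_(i <- s) i).+1; rewrite eA /= => ms.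
have h2 : m <= \max_(i <- s) i := @leq_bigmax_seq _ s xpredT id m ms isT.
lia.
Qed.

Section Killing.
Context (x : set nat) (child : set nat -> nat -> nat -> Prop) (tC : tree_spec x child).
Context (X : set (set nat)) (hX : forall y, X y <-> Acc (above child y) 0).
Context (iltX : ilt X).

Definition cond : Type := seq (bool * rank).
Implicit Types p q r : cond.

Definition bits p : set nat := fun m => (nth (false, set0) p m).1.
Definition ord p (i : nat) : rank := (nth (false, set0) p i).2.

(* [p] is a finite approximation to a real together with a strictly decreasing
   map from its tree to the ordinals. *)
Definition good p : Prop := 0 < size p /\ (valid child (ord p 0) /\
  forall i j, i < size p -> j < size p -> child (bits p) i j -> lto child (ord p j) (ord p i)).

Definition ext p q : Prop := exists r, q = p ++ r.

Definition kill (U : set cond) : set cond := fun p =>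
  (forall e, good (rcons p e) -> U (rcons p e)) \/
  (forall k, exists m, k <= m /\
     forall q, good q -> ext p q -> m < size q -> bits q m \/ U q).

Lemma kill_mono U V : U `<=` V -> kill U `<=` kill V.
Proof.
move=> UV p [h|h]; first by left=> e /h/UV.
right=> k; have [m [km hm]] := h k; exists m; split=> // q gq pq mq.
by have [|/UV] := hm q gq pq mq; [left|right].
Qed.

Notation killed := (killed kill).
Notation stle := (stle kill).

Lemma ext_refl p : ext p p. Proof. by exists [::]; rewrite cats0. Qed.

Lemma ext_trans p q r : ext p q -> ext q r -> ext p r.
Proof. by move=> [s ->] [t ->]; exists (s ++ t); rewrite catA. Qed.

Lemma ext_size p q : ext p q -> size p <= size q.
Proof. by move=> [r ->]; rewrite size_cat leq_addr. Qed.

Lemma ext_nth p q i : ext p q -> i < size p ->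
  nth (false, set0) q i = nth (false, set0) p i.
Proof. by move=> [r ->] ip; rewrite nth_cat ip. Qed.

Lemma ext_bits p q i : ext p q -> i < size p -> bits q i <-> bits p i.
Proof. by move=> pq ip; rewrite /bits (ext_nth pq ip). Qed.

Lemma X_wf y n : X y -> Acc (step child) (y, n).
Proof. by move=> /hX/(root_wf tC). Qed.

(** The ordinals of the conditions fit together to a decreasing map on the tree of the limit,
    because each child relation depends on finitely many bits; so this tree is well-founded. *)
Lemma good_limit (P : nat -> cond) :
  (forall n, good (P n)) -> (forall n, ext (P n) (P n.+1)) -> (forall n, n <= size (P n)) ->
  exists2 z, X z & forall n i, i < size (P n) -> (z i <-> bits (P n) i).
Proof.
move=> gP eP sP; have eP' n k : ext (P n) (P (n + k)).
  elim: k => [|k IH]; first by rewrite addn0; apply: ext_refl.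
  by rewrite addnS; apply: ext_trans IH _.
have nP n i : i < size (P n) ->
    nth (false, set0) (P n) i = nth (false, set0) (P i.+1) i.
  move=> lin; rewrite -(ext_nth (eP' n i.+1)) // addnC.
  by rewrite (ext_nth (eP' i.+1 n)).
exists (fun i => bits (P i.+1) i); last by move=> n i lin; rewrite /bits nP.
apply/hX/wf_above; set v := fun _ => _.
pose h i := ord (P i.+1) i.
have dec i j : child v i j -> lto child (h j) (h i).
  move=> cij; set n := (maxn i j).+1; have [_ [_ hn]] := gP n.
  have iN : i < size (P n) by have := sP n; rewrite /n; lia.
  have jN : j < size (P n) by have := sP n; rewrite /n; lia.
  have := hn i j iN jN; rewrite /ord !nP //; apply.
  have [_ modulus _] := tC; apply: modulus cij => m mj.
  by rewrite /v /bits nP //; lia.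
suff A i o : Acc (lto child) o -> o = h i -> Acc (step child) (v, i).
  by apply: (A 0) erefl; apply: Acc_lto; have [_ [+ _]] := gP 1.
move=> Ao; elim: Ao i => {}o _ IH i e; constructor => -[v' j] [/= -> cij].
by apply: (IH (h j)) => //; rewrite e; apply: dec.
Qed.

(** A survivor would yield two chains of survivors whose limits lie in [X] and each contain
    infinitely many numbers missing from the other, against linearity. *)
Lemma good_killed p : good p -> killed p.
Proof.
move=> gp; apply: contrapT => np.
pose N q := good q /\ ~ killed q.
(* Neither clause of [kill] applies to a survivor: some one-step extension survives, and each large
   [m] is omitted by some surviving extension. *)
have nk q : ~ killed q -> (exists e, N (rcons q e)) /\
    (exists k, forall m, k <= m -> exists q', N q' /\ (ext q q' /\ (m < size q' /\ ~ bits q' m))).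
  move=> nq; have {}nq : ~ kill killed q by move=> Kq; apply: nq; apply: killedK Kq.
  split.
    apply: contrapT => H; apply: nq; left=> e ge; apply: contrapT => ne.
    by apply: H; exists e.
  apply: contrapT => H; apply: nq; right=> k; apply: contrapT => H'.
  apply: H; exists k => m km; apply: contrapT => H''; apply: H'.
  exists m; split=> // q' gq' qq' mq'.
  apply: contrapT => /not_orP[nb nk]; apply: H''.
  by exists q'.
have branch q : N q -> exists2 z, X z & forall n, exists q',
    N q' /\ (ext q q' /\ (n <= size q' /\ forall i, i < size q' -> (z i <-> bits q' i))).
  move=> Nq; have [|f [f0 fP]] := @dep_choice _ N (fun p q => exists e, q = rcons p e) _ Nq.
    by move=> r [_ /nk[[e Ne] _]]; exists (rcons r e); split=> //; exists e.
  have ef n : ext (f n) (f n.+1).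
    by have [_ [e ->]] := fP n; exists [:: e]; rewrite cats1.
  have sf n : n <= size (f n).
    by elim: n => // n IH; have [_ [e ->]] := fP n; rewrite size_rcons.
  have [|//|//|z Xz hz] := @good_limit f; first by move=> n; have [[]] := fP n.
  exists z => // n; exists (f n); split; first by have [] := fP n.
  split; last by split=> //; apply: hz.
  by elim: n => [|n IH]; [rewrite f0; apply: ext_refl|apply: ext_trans IH _].
(* A branch through [q] is a member of [X], hence infinite, and supplies a large [m] in some [q'];
   this [m] can be omitted below [r]. *)
have cross q r n : N q -> N r -> exists q' r' m, [/\ N q', N r', ext q q', ext r r' &
    [/\ n <= m, m < size q', m < size r', bits q' m & ~ bits r' m]].
  move=> Nq Nr; have [k hk] := (nk r Nr.2).2; have [z Xz hz] := branch q Nq.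
  have [iX _ _] := iltX.
  have [m lm zm] := (infinite_setP_nat z).1 (iX z Xz) (maxn n k).
  have [q' [Nq' [qq' [mq' zq']]]] := hz m.+1.
  have [|r' [Nr' [rr' [mr' br']]]] := hk m; first lia.
  by exists q', r', m; split=> //; split=> //; [lia|apply/zq'].
(* Pairs of survivors with a counter; each round separates the two sides in both directions, beyond
   the counter. *)
pose P (s : cond * cond * nat) := N s.1.1 /\ N s.1.2.
pose R (s t : cond * cond * nat) := [/\ ext s.1.1 t.1.1, ext s.1.2 t.1.2, t.2 = s.2.+1,
  exists m, [/\ s.2 <= m, m < size t.1.1, m < size t.1.2, bits t.1.1 m & ~ bits t.1.2 m] &
  exists m, [/\ s.2 <= m, m < size t.1.1, m < size t.1.2, ~ bits t.1.1 m & bits t.1.2 m]].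
have [|[[q r] n] [/= Nq Nr]|f [f0 fP]] := @dep_choice _ P R (p, p, 0); first by [].
  have [q1 [r1 [m1 [Nq1 Nr1 e1 e1' [h1 h2 h3 h4 h5]]]]] := cross q r n Nq Nr.
  have [r2 [q2 [m2 [Nr2 Nq2 e2 e2' [h6 h7 h8 h9 h10]]]]] := cross r1 q1 n Nr1 Nq1.
  exists (q2, r2, n.+1); split=> //; split=> //=.
  - exact: ext_trans e1 e2'.
  - exact: ext_trans e1' e2.
  - exists m1; have := ext_size e2; have := ext_size e2' => ? ?.
    by split=> //; [lia|lia|apply/(ext_bits e2')|move=> /(ext_bits e2 h3)].
  - by exists m2.
have f2 n : (f n).2 = n.
  by elim: n => [|n IH]; [rewrite f0|have [_ [_ _ -> _ _]] := fP n; rewrite IH].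
have [||m|y Xy hy] := @good_limit (fun n => (f n).1.1).
- by move=> n; have [[[]]] := fP n.
- by move=> n; have [_ []] := fP n.
- case: m => // m; have [_ [_ _ _ [k []]]] := fP m.
  by rewrite f2; lia.
have [||m|z Xz hz] := @good_limit (fun n => (f n).1.2).
- by move=> n; have [[_ []]] := fP n.
- by move=> n; have [_ []] := fP n.
- case: m => // m; have [_ [_ _ _ [k []]]] := fP m.
  by rewrite f2; lia.
have [_ [_ _ _ tot] _] := iltX.
have [|] := tot y z Xy Xz; apply/infinite_setP_nat => n.
  have [_ [_ _ _ [m [le my mz b nb]] _]] := fP n; rewrite f2 in le.
  by exists m => //; split; [apply/(hy n.+1)|move=> /(hz n.+1 _ mz)].
have [_ [_ _ _ _ [m [le my mz nb b]]]] := fP n; rewrite f2 in le.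
by exists m => //; split; [apply/(hz n.+1)|move=> /(hy n.+1 _ my)].
Qed.

(** * Initial segments of members and their labels *)

Definition approx_of (y : set nat) (k : nat) : cond :=
  mkseq (fun i => (`[< y i >], rk child (y, i))) k.

Lemma bits_approx_of y k i : i < k -> bits (approx_of y k) i <-> y i.
Proof. by move=> ik; rewrite /bits nth_mkseq //=; split=> /asboolP. Qed.

Lemma approx_of_ext y j k : j <= k -> ext (approx_of y j) (approx_of y k).
Proof.
move=> jk; exists (drop j (approx_of y k)); rewrite -[LHS](cat_take_drop j); congr (_ ++ _).
by rewrite /approx_of /mkseq -map_take take_iota (minn_idPl jk).
Qed.

Lemma approx_of_good y k : X y -> 0 < k -> good (approx_of y k).
Proof.
move=> Xy k0; rewrite /good size_mkseq; split=> //; split.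
  by rewrite /ord nth_mkseq //; exists (y, 0); [exact: X_wf|].
move=> i j ik jk cij; rewrite /ord !nth_mkseq //=.
apply/lto_rk; [exact: X_wf|exact: X_wf|apply: step_rlt; split=> //=].
by have [_ modulus _] := tC; apply: modulus cij => m mj; rewrite bits_approx_of //; lia.
Qed.

(** The slices for positive [k] form a countable cover of [X]; ties are allowed, so they may
    overlap. *)
Definition slice (k : nat) (y : set nat) : Prop :=
  X y /\ forall j, 0 < j -> stle (approx_of y k) (approx_of y j).

Lemma slice_ex y : X y -> exists2 k, 0 < k & slice k y.
Proof.
move=> Xy; have [|p [k k0 ->] hk] :=
  @stle_min _ _ kill_mono (fun p => exists2 k, 0 < k & p = approx_of y k).
  by exists (approx_of y 1); [exists 1|apply/good_killed/approx_of_good].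
by exists k => //; split=> // j j0; apply: hk; exists j.
Qed.

(* The intersection of all conditions below [p] that are alive when [p] is killed. *)
Definition alive_meet p : set nat := fun m =>
  forall q, good q -> ext p q -> m < size q -> stle p q -> bits q m.

(** The first clause of [kill] would need the initial segment of length [k.+1] to be killed strictly
    earlier. So the second clause applies, and it provides the elements. *)
Lemma alive_meet_infinite k y : 0 < k -> slice k y -> infinite_set (alive_meet (approx_of y k)).
Proof.
move=> k0 [Xy h]; apply/infinite_setP_nat => n.
have gk := approx_of_good Xy k0.
have /(stleP kill_mono _ (good_killed gk)) [H|H] := stle_refl (K := kill) (p := approx_of y k).
  have e : rcons (approx_of y k) (`[< y k >], rk child (y, k)) = approx_of y k.+1.
    by rewrite /approx_of /mkseq -addn1 iotaD map_cat cats1.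
  by have := H (`[< y k >], rk child (y, k)); rewrite e => /(_ (approx_of_good Xy (ltn0Sn k))) [];
    apply: h.
have [m [nm hm]] := H n; exists m => // q gq pq mq st.
by have [|//] := hm q gq pq mq.
Qed.

(** By the choice of [k], the longer initial segments of [y] are among the conditions that are still
    alive. *)
Lemma alive_meet_sub k y : slice k y -> alive_meet (approx_of y k) `<=` y.
Proof.
move=> [Xy h] m hm; have le : k <= maxn k m.+1 by lia.
have lm : m < maxn k m.+1 by lia.
apply/(bits_approx_of y lm); apply: hm; rewrite ?size_mkseq //.
- by apply: approx_of_good => //; lia.
- exact: approx_of_ext.
- by apply: h; lia.
Qed.

(* A number [2 n + b] stands for the pair of the bit [b] and the rank of the node [n]. *)
Definition letter (y : set nat) (n : nat) : bool * rank := (odd n, rk child (y, n./2)).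
Definition word (y : set nat) (l : seq nat) : cond := map (letter y) l.

(** All later ordinals of [q] lie below its root value, which is a rank in the tree of [y], so
    [lto_realized] names them by nodes of that tree. Hence the killing process below such a
    condition involves only numbers. *)
Lemma word_ext y l q : X y -> 0 < size l -> good q -> ext (word y l) q ->
  exists r : seq nat, q = word y (l ++ r).
Proof.
move=> Xy l0 gq [s e]; suff [r es] : exists r : seq nat, s = word y r.
  by exists r; rewrite e es /word map_cat.
have q0 : ord q 0 = rk child (y, (nth 0 l 0)./2).
  by rewrite /ord e nth_cat size_map l0 (nth_map 0).
have re i : 0 < i -> i < size q -> exists n, nth (false, set0) q i = letter y n.
  move=> i0 iq; have [lt0 [_ h]] := gq; have [_ _ root] := tC.
  have := h 0 i lt0 iq ((root _ _).2 i0); rewrite q0.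
  move=> /(lto_realized (X_wf _ Xy))[n en].
  exists (2 * n + (nth (false, set0) q i).1); rewrite /letter.
  have -> : odd (2 * n + (nth (false, set0) q i).1) = (nth (false, set0) q i).1.
    by rewrite oddD mul2n odd_double oddb.
  have -> : (2 * n + (nth (false, set0) q i).1)./2 = n by case: (nth _ _ _).1; lia.
  by move: en; rewrite /ord; case: (nth _ _ _) => b o /= ->.
have {re} : forall i, i < size s -> exists n, nth (false, set0) s i = letter y n.
  move=> i il; have [||n hn] := re (size l + i); [lia|by rewrite e size_cat size_map; lia|].
  by exists n; rewrite -hn e nth_cat size_map ltnNge leq_addr addKn.
elim: (s) => [|a t IH] h; first by exists [::].
have [n /= ->] := h 0 isT; have [i it|r ->] := IH; first exact: (h i.+1).
by exists (n :: r).
Qed.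

End Killing.

(** * Definability of the killing stages *)

Definition cbits (c : nat) : set nat := fun m => exists h, ent c m = 2 * h + 1.
Definition cnode (c i : nat) : nat := (ent c i)./2.

Definition cext (c d : nat) : Prop :=
  size (decode c) <= size (decode d) /\
  forall i, i < size (decode c) -> ent d i = ent c i.

Lemma cextP c d : cext c d <-> exists r, decode d = decode c ++ r.
Proof.
split=> [[le h]|[r e]]; last first.
  by rewrite /cext /ent e size_cat leq_addr; split=> // i ic; rewrite nth_cat ic.
exists (drop (size (decode c)) (decode d)).
rewrite -[LHS](cat_take_drop (size (decode c))); congr (_ ++ _).
apply: (@eq_from_nth _ 0); first by rewrite size_take; case: ltngtP le.
by move=> i; rewrite size_takel // => ic; rewrite nth_take //; apply: h.
Qed.

Section CodesDefinable.
Context (C : Type) (en : C -> seq nat) (ev : C -> seq (set nat)).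

Lemma sdef_cbits c : ndef en ev c -> sdef en ev (fun p => cbits (c p)).
Proof. by move=> hc; rewrite /cbits; ar. Qed.

Lemma ndef_cnode c i : ndef en ev c -> ndef en ev i -> ndef en ev (fun p => cnode (c p) (i p)).
Proof.
move=> hc hi; rewrite /ndef /cnode.
apply: (arith_eqv (Q := fun p => ent (c p.1) (i p.1) = 2 * p.2 \/
                                 ent (c p.1) (i p.1) = 2 * p.2 + 1)); last by ar.
by move=> p; split; lia.
Qed.

Lemma arith_cext c d : ndef en ev c -> ndef en ev d -> arith en ev (fun p => cext (c p) (d p)).
Proof. by move=> hc hd; rewrite /cext; ar. Qed.

End CodesDefinable.

Ltac ar_atom ::=
  match goal with
  | |- ndef _ _ (fun _ => cpair _ _) => apply: ndef_cpair
  | |- ndef _ _ (fun _ => size (decode _)) => apply: ndef_size_decode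
  | |- ndef _ _ (fun _ => ent _ _) => apply: ndef_ent
  | |- ndef _ _ (fun _ => cnode _ _) => apply: ndef_cnode
  | |- sdef _ _ (fun _ => cbits _) => apply: sdef_cbits
  | |- sdef _ _ (fun _ => part _ _) => apply: sdef_part
  | |- sdef _ _ (fun _ => join _ _) => apply: sdef_join
  | |- arith _ _ (fun _ => cext _ _) => apply: arith_cext
  | |- _ => ar_child
  end.

Section Tables.
Context (x : set nat) (child : set nat -> nat -> nat -> Prop) (tC : tree_spec x child).

(** Strict decrease of ranks is expressed as failure of the reverse comparison in [L0]. *)
Definition gcode (L0 : set nat) (c : nat) : Prop :=
  0 < size (decode c) /\ forall i j, i < size (decode c) -> j < size (decode c) ->
    child (cbits c) i j -> ~ L0 (cpair (cnode c i) (cnode c j)).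

Definition ckill (L0 : set nat) (U : set nat) : set nat := fun c =>
  (forall d, cext c d -> size (decode d) = (size (decode c)).+1 -> gcode L0 d -> U d) \/
  (forall k, exists m, k <= m /\ forall d, gcode L0 d -> cext c d ->
     m < size (decode d) -> cbits d m \/ U d).

(* [Z] codes the comparison of the ranks of the nodes of the tree of [y] and the
   comparison of the killing stages of the conditions with ranks from that tree. *)
Definition table (y Z : set nat) : Prop :=
  (forall a b, part 0 Z (cpair a b) <->
     forall a', child y a a' -> exists b', child y b b' /\ part 0 Z (cpair a' b')) /\
  (forall c d, gcode (part 0 Z) c -> gcode (part 0 Z) d ->
     (part 1 Z (cpair c d) <-> ckill (part 0 Z) (fun e => ~ part 1 Z (cpair d e)) c)).

(** A code of the initial segment of [y] of length [k] in which each node names its own rank. *)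
Definition pcode (y : set nat) (k c : nat) : Prop :=
  size (decode c) = k /\
  forall i, i < k -> (y i /\ ent c i = 2 * i + 1) \/ (~ y i /\ ent c i = 2 * i).

Definition slice_code (k : nat) (y Z : set nat) : Prop :=
  forall j c d, 0 < j -> pcode y k c -> pcode y j d -> part 1 Z (cpair c d).

Definition label_code (k : nat) (y Z : set nat) (m : nat) : Prop :=
  forall c d, pcode y k c -> gcode (part 0 Z) d -> cext c d -> m < size (decode d) ->
    part 1 Z (cpair c d) -> cbits d m.

Section TablesDefinable.
Context (C : Type) (en : C -> seq nat) (ev : C -> seq (set nat)).
Context (y Z : C -> set nat).
Context (hx : sdef en ev (fun _ => x)) (hy : sdef en ev y) (hZ : sdef en ev Z).

Lemma arith_table : arith en ev (fun c => table (y c) (Z c)).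
Proof. by rewrite /table /ckill /gcode; ar. Qed.

Lemma arith_slice_code k : arith en ev (fun c => slice_code k (y c) (Z c)).
Proof. by rewrite /slice_code /pcode; ar. Qed.

Lemma arith_label_code k m : ndef en ev m -> arith en ev (fun c => label_code k (y c) (Z c) (m c)).
Proof. by move=> hm; rewrite /label_code /pcode /gcode; ar. Qed.

End TablesDefinable.

(** * Existence and correctness of tables for members of the set *)

Context (X : set (set nat)) (hX : forall y, X y <-> Acc (above child y) 0) (iltX : ilt X).
Context (y : set nat) (Xy : X y).

Notation good := (good child).
Notation cword c := (word child y (decode c)).
Notation stle := (stle (kill child)).

Lemma size_cword c : size (cword c) = size (decode c).
Proof. by rewrite size_map. Qed.

Lemma bits_cword c m : bits (cword c) m <-> cbits c m.
Proof.
have -> : bits (cword c) m = odd (ent c m).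
  rewrite /bits /ent; have [lt|le] := ltnP m (size (decode c)).
    by rewrite (nth_map 0).
  by rewrite !nth_default ?size_map.
split=> [o|[h ->]]; last by lia.
by exists (ent c m)./2; lia.
Qed.

Lemma ord_cword c i : i < size (decode c) -> ord (cword c) i = rk child (y, cnode c i).
Proof. by move=> ic; rewrite /ord (nth_map 0). Qed.

Lemma gcode_good L0 : (forall a b, L0 (cpair a b) <-> rle child (y, a) (y, b)) ->
  forall c, gcode L0 c <-> good (cword c).
Proof.
move=> hL c; have eb : bits (cword c) = cbits c.
  by apply/funext => m; apply/propext; apply: bits_cword.
have wf n : Acc (step child) (y, n) by exact: (X_wf tC hX n Xy).
rewrite /gcode /good size_map eb; split=> [[s0 h]|[s0 [_ h]]]; split=> //.
  split; first by rewrite ord_cword //; exists (y, cnode c 0); [exact: wf|].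
  move=> i j ic jc cij; rewrite !ord_cword //; apply/(lto_rk (wf _) (wf _)).
  by apply: (rle_total (wf _)) => /hL; apply: h.
move=> i j ic jc cij /hL le; have := h i j ic jc cij.
by rewrite !ord_cword // => /(lto_rk (wf _) (wf _)); apply: rle_rltF.
Qed.

(** On a well-founded tree the first clause of [table] has a unique solution, by induction on the
    left node. *)
Lemma table_rle Z : table y Z -> forall a b, part 0 Z (cpair a b) <-> rle child (y, a) (y, b).
Proof.
move=> [h _] a; have := X_wf tC hX a Xy.
suff H p : Acc (step child) p -> forall a, p = (y, a) ->
    forall b, part 0 Z (cpair a b) <-> rle child (y, a) (y, b) by move=> /H; apply.
elim=> {}p _ IH {}a e b; rewrite h rleP; split=> H.
  move=> [y' a'] [/= -> ca]; have [b' [cb Zab]] := H a' ca.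
  have st : step child (y, a') p by rewrite e; split.
  by exists (y, b'); split; [split|apply/(IH _ st a' erefl b')].
move=> a' ca; have st : step child (y, a') p by rewrite e; split.
have [[y' b'] [[/= -> cb] ab]] := H (y, a') (conj erefl ca).
by exists b'; split=> //; apply/(IH _ st a' erefl b').
Qed.

Lemma cext_ext c d : cext c d -> ext (cword c) (cword d).
Proof. by move=> /cextP[r e]; exists (word child y r); rewrite /word e map_cat. Qed.

Lemma ext_code c q : good (cword c) -> good q -> ext (cword c) q ->
  exists2 d, cext c d & q = cword d.
Proof.
move=> [c0 _] gq cq; rewrite size_map in c0.
have [r ->] := word_ext tC hX Xy c0 gq cq.
have [d e] := decode_surj (decode c ++ r).
by exists d; [apply/cextP; exists r|rewrite e].
Qed.

Section Correct.
Context (L0 : set nat) (hL : forall c, gcode L0 c <-> good (cword c)).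

(** Good extensions of a coded condition are all coded, so quantifying over codes loses nothing. *)
Lemma kill_code (U : set (cond)) c : gcode L0 c ->
  kill child U (cword c) <-> ckill L0 (fun d => U (cword d)) c.
Proof.
move=> /hL gc; split=> -[H|H].
- left=> d cd sd /hL gd; have [r e] := (cextP c d).1 cd.
  have := cd; case: r e => [|n [|n' r]] e _; move: sd; rewrite e size_cat /=; [lia| |lia].
  move=> _; have ew : cword d = rcons (cword c) (letter child y n).
    by rewrite /word e map_cat cats1.
  by have := H (letter child y n); rewrite -ew => /(_ gd); rewrite e.
- right=> k; have [m [km hm]] := H k; exists m; split=> // d /hL gd /cext_ext cd md.
  by have [|/bits_cword|] := hm _ gd cd; rewrite ?size_cword //; [left|right].
- left=> e ge; have [|d cd ed] := ext_code gc ge; first by exists [:: e]; rewrite cats1.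
  rewrite ed; apply: H => //; last by apply/hL; rewrite -ed.
  by rewrite -!size_cword -ed size_rcons.
- right=> k; have [m [km hm]] := H k; exists m; split=> // q gq cq.
  have [d cd ed] := ext_code gc gq cq; rewrite ed size_cword => md.
  have [|/bits_cword|] := hm d _ cd md; [by apply/hL; rewrite -ed|by left|by right].
Qed.

Lemma ckill_mono U V c :
  (forall d, gcode L0 d -> U d -> V d) -> ckill L0 U c -> ckill L0 V c.
Proof.
move=> UV [H|H]; first by left=> d cd sd gd; apply: UV (gd) _; apply: H.
right=> k; have [m [km hm]] := H k; exists m; split=> // d gd cd md.
by have [|/(UV _ gd)] := hm d gd cd md; [left|right].
Qed.

Lemma gcode_killed c : gcode L0 c -> killed (kill child) (cword c).
Proof. by move=> /hL; apply: (good_killed tC hX iltX). Qed.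

End Correct.

Lemma table_gcode Z : table y Z -> forall c, gcode (part 0 Z) c <-> good (cword c).
Proof. by move=> tZ; apply: gcode_good; apply: table_rle. Qed.

Lemma table_stle Z : table y Z -> forall c d, good (cword c) -> good (cword d) ->
  part 1 Z (cpair c d) <-> stle (cword c) (cword d).
Proof.
move=> tZ c d; have hL := table_gcode tZ; rewrite -!hL => gc gd.
apply: (stle_unique (@kill_mono child) (@ckill_mono (part 0 Z)) (kill_code hL)
  (gcode_killed hL) (L := fun c d => part 1 Z (cpair c d))) => //.
by case: tZ.
Qed.

(** With the correctness of all tables, existence lets a fact about a member of [X] be read off from
    some table or equally from every table, which is its $\Delta^1_1$ form. *)
Lemma table_ex : exists Z, table y Z.
Proof.
pose L0 : set nat := fun m => exists a b, m = cpair a b /\ rle child (y, a) (y, b).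
have L0P a b : L0 (cpair a b) <-> rle child (y, a) (y, b).
  by split=> [[a' [b' [/cpair_inj[-> ->]]]]|]; [|exists a, b].
pose L : set nat := fun m => exists c d, m = cpair c d /\ stle (cword c) (cword d).
have LP c d : L (cpair c d) <-> stle (cword c) (cword d).
  by split=> [[c' [d' [/cpair_inj[-> ->]]]]|]; [|exists c, d].
have hL := gcode_good L0P.
exists (join L0 L); rewrite /table part0_join part1_join; split=> [a b|c d gc gd].
  rewrite L0P rleP; split=> H.
    move=> a' ca; have [[y' b'] [[/= -> cb] ab]] := H (y, a') (conj erefl ca).
    by exists b'; split=> //; apply/L0P.
  move=> [y' a'] [/= -> ca]; have [b' [cb /L0P ab]] := H a' ca.
  by exists (y, b'); split=> //; split.
rewrite LP (stleP (@kill_mono child)); last exact: (gcode_killed hL).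
rewrite (kill_code hL) //; suff -> : (fun e => ~ L (cpair d e)) =
    (fun e => ~ stle (cword d) (cword e)) by [].
by apply/funext => e; apply/propext; rewrite LP.
Qed.

Lemma pcode_ex k : exists c, pcode y k c.
Proof.
have [c e] := decode_surj (mkseq (fun i => 2 * i + `[< y i >]) k).
exists c; rewrite /pcode /ent e size_mkseq; split=> // i ik; rewrite nth_mkseq //.
by case: asboolP => yi; [left|right; rewrite addn0].
Qed.

Lemma pcodeE k c : pcode y k c -> cword c = approx_of child y k.
Proof.
move=> [sc h]; apply: (@eq_from_nth _ (false, set0)); rewrite size_map sc ?size_mkseq //.
move=> i ik; rewrite (nth_map 0) ?sc // nth_mkseq // /letter -/(ent c i).
case: (h i ik) => -[yi ->]; [rewrite asboolT|rewrite asboolF] => //; congr (_, rk _ (_, _));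
  lia.
Qed.

Lemma table_slice k Z : 0 < k -> table y Z -> slice_code k y Z <-> slice child X k y.
Proof.
move=> k0 tZ; split=> [h|[_ h] j c d j0 pc pd].
  split=> // j j0; have [c pc] := pcode_ex k; have [d pd] := pcode_ex j.
  rewrite -(pcodeE pc) -(pcodeE pd); apply/(table_stle tZ); last exact: h pd.
    by rewrite (pcodeE pc); apply: (approx_of_good tC hX).
  by rewrite (pcodeE pd); apply: (approx_of_good tC hX).
apply/(table_stle tZ); rewrite ?(pcodeE pc) ?(pcodeE pd); last exact: h.
  by apply: (approx_of_good tC hX).
by apply: (approx_of_good tC hX).
Qed.

Lemma table_label k Z m : 0 < k -> table y Z ->
  label_code k y Z m <-> alive_meet child (approx_of child y k) m.
Proof.
move=> k0 tZ; have gk := approx_of_good tC hX Xy k0; have hL := table_gcode tZ; split=> h.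
  move=> q gq kq mq st; have [c pc] := pcode_ex k; rewrite -(pcodeE pc) in gk kq st.
  have [d cd ed] := ext_code gk gq kq; rewrite ed in gq st mq *.
  apply/bits_cword; rewrite size_cword in mq.
  by apply: (h c d) => //; [apply/hL|apply/(table_stle tZ)].
move=> c d pc /hL gd cd md /(table_stle tZ); rewrite (pcodeE pc) => /(_ gk gd) st.
apply/bits_cword; apply: h => //; last by rewrite size_cword.
by rewrite -(pcodeE pc); apply: cext_ext.
Qed.

End Tables.

(** * The tower *)

Lemma almost_subsetP (y z : set nat) :
  almost_subset y z <-> exists n, forall m, n <= m -> y m -> z m.
Proof.
rewrite /almost_subset; split=> [fi|[n h]].
  apply: contrapT => H.
  suff : infinite_set (y `\` z) by apply.
  apply/infinite_setP_nat => k; apply: contrapT => H'; apply: H; exists k => m km ym.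
  by apply: contrapT => nz; apply: H'; exists m.
apply: contrapT => /infinite_setP_nat/(_ n)[m nm [ym nz]]; apply: nz; exact: h nm ym.
Qed.

Lemma almost_subset_trans u v w :
  almost_subset u v -> almost_subset v w -> almost_subset u w.
Proof.
move=> /almost_subsetP[n h] /almost_subsetP[k h']; apply/almost_subsetP.
by exists (maxn n k) => m le um; apply: h'; [lia|apply: h um; lia].
Qed.

Lemma subset_almost u v : u `<=` v -> almost_subset u v.
Proof. by move=> uv; apply/almost_subsetP; exists 0 => m _ /uv. Qed.

(** Otherwise the [u n] would be coinitial in [X], and choosing ever larger [g n] in the
    intersection of [u 0], ..., [u n] would give a pseudointersection. *)
Lemma ilt_lower_bound X (u : nat -> set nat) : ilt X -> (forall n, X (u n)) ->
  exists2 y, X y & forall n, almost_subset y (u n).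
Proof.
move=> [iX [_ _ _ tot] nX] Xu; apply: contrapT => H; apply: nX.
have below y : X y -> exists n, almost_subset (u n) y.
  move=> Xy; apply: contrapT => nb; apply: H; exists y => // n.
  by have [//|h] := tot y (u n) Xy (Xu n); case: nb; exists n.
have mins n : exists j, forall i, i <= n -> almost_subset (u j) (u i).
  elim: n => [|n [j hj]].
    by exists 0 => i; rewrite leqn0 => /eqP->; apply: subset_almost.
  have [h|h] := tot (u j) (u n.+1) (Xu j) (Xu _).
    by exists j => i; rewrite leq_eqVlt => /orP[/eqP->//|]; rewrite ltnS; apply: hj.
  exists n.+1 => i; rewrite leq_eqVlt => /orP[/eqP->|]; first exact: subset_almost.
  by rewrite ltnS => /hj; apply: almost_subset_trans.
(* The least of [u 0], ..., [u n] is infinite and almost contained in each of them, so beyond some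
   bound its elements lie in all of them. *)
have meet n k : exists m, k <= m /\ forall i, i <= n -> u i m.
  have [j hj] := mins n.
  have [N hN] : exists N, forall m, N <= m -> u j m -> forall i, i <= n -> u i m.
    elim: (n) hj => [|p IH] hj.
      have /almost_subsetP[N h] := hj 0 (leq0n 0).
      by exists N => m Nm ujm i; rewrite leqn0 => /eqP->; apply: h.
    have [i ip|N h] := IH; first by apply: hj; lia.
    have /almost_subsetP[N' h'] := hj p.+1 (leqnn _).
    exists (maxn N N') => m le ujm i; rewrite leq_eqVlt => /orP[/eqP->|ip].
      by apply: h' => //; lia.
    by apply: h ip => //; lia.
  have [m le ujm] := (infinite_setP_nat (u j)).1 (iX _ (Xu j)) (maxn N k).
  by exists m; split; [lia|apply: hN ujm; lia].
have /choice[f hf] p := meet p.1 p.2.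
pose g := fix g n := if n is k.+1 then f (k.+1, (g k).+1) else f (0, 0).
have gS n : g n < g n.+1 by have [] := hf (n.+1, (g n).+1).
have gu n i : i <= n -> u i (g n).
  by case: n => [|n] le; [have [_] := hf (0, 0)|have [_] := hf (n.+1, (g n).+1)]; apply.
have gmono n k : g n <= g (n + k).
  by elim: k => [|k IH]; [rewrite addn0|rewrite addnS; have := gS (n + k); lia].
exists (fun m => exists n, g n = m); split.
  apply/infinite_setP_nat => k; exists (g k); last by exists k.
  by elim: k => // k; have := gS k; lia.
move=> y /below[i]; apply: almost_subset_trans.
apply/almost_subsetP; exists (g i) => m le [n gm]; rewrite -gm in le *; apply: gu.
rewrite leqNgt; apply/negP => ni; have := gmono n.+1 (i - n.+1).
by rewrite subnKC //; have := gS n; lia.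
Qed.

Lemma ilt_total X y z : ilt X -> X y -> X z -> ~ almost_subset z y -> almost_subset y z.
Proof. by move=> [_ [_ _ _ tot] _] Xy Xz; have [] := tot y z Xy Xz. Qed.

(** * Records and the choice of one record per label *)

Section Tower.
Context (x : set nat) (X : set (set nat)) (pX : Pi11 x X) (iltX : ilt X).
Context (child : set nat -> nat -> nat -> Prop) (tC : tree_spec x child).
Context (hX : forall y, X y <-> Acc (above child y) 0).

Notation slice := (slice child X).
Notation label y k := (alive_meet child (approx_of child y k)).

(** If each slice failed at some [u k], a common lower bound of the [u k] would still belong to some
    slice. *)
Lemma slice_coinitial : exists k, 0 < k /\
  forall w, X w -> exists y, slice k y /\ almost_subset y w.
Proof.
have [w0 Xw0] : exists w, X w.
  (* If [X] were empty, [setT] would be a pseudointersection. *)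
  apply: contrapT => nX; have [_ _] := iltX; apply; exists setT.
  by split; [exact: infinite_nat|move=> z Xz; case: nX; exists z].
apply: contrapT => H.
have nc k : exists w, X w /\ (0 < k -> forall y, slice k y -> ~ almost_subset y w).
  have [k0|k0] := pselect (0 < k); last by exists w0.
  apply: contrapT => H'; apply: H; exists k; split=> // w Xw.
  apply: contrapT => H''; apply: H'; exists w; split=> // _ y Xy yw.
  by apply: H''; exists y.
have /choice[u hu] := nc.
have [n|y Xy yu] := ilt_lower_bound iltX (u := u); first by have [] := hu n.
have [k k0 Xk] := slice_ex tC hX iltX Xy.
by have [_ /(_ k0 y Xk)] := hu k; apply.
Qed.

Context (k : nat) (k0 : 0 < k).
Context (coinit : forall w, X w -> exists y, slice k y /\ almost_subset y w).

Definition lexk (z y : set nat) : Prop :=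
  exists n, n < k /\ (eqlex child n z y /\ ltat child n z y).

Definition record (y : set nat) : Prop := slice k y /\
  forall z, slice k z -> lexk z y -> almost_subset y z /\ ~ almost_subset z y.

Let wX y n (Xy : X y) : Acc (step child) (y, n) := X_wf tC hX n Xy.

Lemma lexk_X z y : X y -> lexk z y -> X z.
Proof.
move=> Xy [n [_ [e l]]]; apply/hX/wf_above; have w0 := wX 0 Xy.
case: n e l => [_ [/rlt_wf|[/rle_wf]]|n e _]; [by apply|by move=> h _; apply: h|].
by have [[le _] _] := e 0 isT; apply: rle_wf le w0.
Qed.

Lemma slice_leftmost (M : set nat -> Prop) : (forall y, M y -> X y) -> (exists y, M y) ->
  exists2 y, M y & forall z, M z -> ~ lexk z y.
Proof.
move=> MX Mne; have wM u n : M u -> Acc (step child) (u, n) by move=> /MX/wX.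
have [y ly] := leftmost_ex wM k Mne.
exists y; first exact: leftmost_le (leq0n k) ly.
by move=> z Mz [n [nk [e]]]; apply: leftmost_min Mz ly nk e.
Qed.

Lemma lexk_total z y : X z -> X y -> ~ lexk z y -> ~ lexk y z -> eqlex child k z y.
Proof.
move=> Xz Xy nzy nyz; suff h n : n <= k -> eqlex child n z y by apply: h.
elim: n => // n IH nk j; rewrite ltnS leq_eqVlt => /orP[/eqP->|]; last by apply: IH; lia.
have e : eqlex child n z y by apply: IH; lia.
have e' : eqlex child n y z by move=> i /e/eqat_sym.
by apply: (ltat_total (wX n Xz) (wX n Xy)) => l; [apply: nzy|apply: nyz]; exists n.
Qed.

Lemma eqlex_approx_of z y : X z -> X y -> eqlex child k z y ->
  approx_of child z k = approx_of child y k.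
Proof.
move=> Xz Xy e; apply: (@eq_from_nth _ (false, set0)); rewrite !size_mkseq // => i ik.
rewrite !nth_mkseq //; have [r b] := e i ik; congr (_, _).
  by congr asbool; apply/propext.
exact/(rk_eq (wX i Xz) (wX i Xy)).
Qed.

Section RecordDefinable.
Context (C : Type) (en : C -> seq nat) (ev : C -> seq (set nat)) (y : C -> set nat).
Context (hx : sdef en ev (fun _ => x)) (hy : sdef en ev y).

Lemma S11_lexk z : sdef en ev z -> S11 en ev (fun c => lexk (z c) (y c)).
Proof.
move=> hz; apply: S11_ex; apply: S11_and; first by apply: S11_arith; ar.
by apply: S11_and; [apply: (S11_eqlex tC); ar|apply: (S11_ltat tC); ar].
Qed.

End RecordDefinable.

Lemma arith_almost_subset C (en : C -> seq nat) ev y z :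
  sdef en ev y -> sdef en ev z -> arith en ev (fun c => almost_subset (y c) (z c)).
Proof.
move=> hy hz; apply: arith_eqv; first by move=> c; apply: almost_subsetP.
by ar.
Qed.

(** The table of [y] is quantified universally, while that of [z] occurs in a premise. There [z] is
    an arbitrary real, and [lexk_X] puts it in [X], where tables are correct. *)
Lemma P11_record C (en : C -> seq nat) ev y :
  sdef en ev (fun _ => x) -> sdef en ev y -> P11 en ev (fun c => record (y c)).
Proof.
move=> hx hy; apply: (P11_eqv (Q := fun c => X (y c) /\
    ((forall Z, table child (y c) Z -> slice_code k (y c) Z) /\
     forall z Z, table child z Z /\ (slice_code k z Z /\ lexk z (y c)) ->
       almost_subset (y c) z /\ ~ almost_subset z (y c)))).
  move=> c; rewrite /record; split=> [[Xk h]|[Xy [h h']]].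
    have [Xy _] := Xk; split=> //; split=> [Z tZ|z Z [tZ [xZ l]]].
      exact/(table_slice tC hX iltX Xy k0 tZ).
    have Xz := lexk_X Xy l.
    by apply: h => //; apply/(table_slice tC hX iltX Xz k0 tZ).
  have [Z tZ] := table_ex tC hX iltX Xy; split.
    by apply/(table_slice tC hX iltX Xy k0 tZ); apply: h.
  move=> z Xk l; have [Xz _] := Xk; have [W tW] := table_ex tC hX iltX Xz.
  by apply: (h' z W); split=> //; split=> //; apply/(table_slice tC hX iltX Xz k0 tW).
apply: P11_and; first exact: (P11_of_Pi11 pX).
apply: P11_and.
  apply: P11_allset; apply: P11_imp; first by apply: S11_arith; apply: (arith_table tC); ar.
  by apply: P11_arith; apply: arith_slice_code; ar.
apply: P11_allset; apply: P11_allset; apply: P11_imp; last first.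
  by apply: P11_arith; apply: arith_and; [|apply: arith_not];
    apply: arith_almost_subset; ar.
apply: S11_and; first by apply: S11_arith; apply: (arith_table tC); ar.
apply: S11_and; first by apply: S11_arith; apply: arith_slice_code; ar.
by apply: S11_lexk; ar.
Qed.

(* [v] codes the pair of the member [part 1 v] and its label [part 0 v]. *)
Definition labelled (v : set nat) : Prop :=
  record (part 1 v) /\ forall m, part 0 v m <-> label (part 1 v) k m.

Lemma Pi11_labelled : Pi11 x labelled.
Proof.
apply: Pi11_of_P11.
have hx : sdef (fun _ : set nat => [::]) (fun y => [:: y; x]) (fun _ => x).
  by exists (AMem (AVar 0) 1).
have hv : sdef (fun _ : set nat => [::]) (fun y => [:: y; x]) id.
  by exists (AMem (AVar 0) 0).
apply: (P11_eqv (Q := fun v => record (part 1 v) /\ forall Z, table child (part 1 v) Z ->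
    forall m, part 0 v m <-> label_code child k (part 1 v) Z m)).
  move=> v; rewrite /labelled; split=> -[rv h]; split=> //; have [[Xv _] _] := rv.
    by move=> Z tZ m; rewrite h (table_label tC hX iltX Xv m k0 tZ).
  have [Z tZ] := table_ex tC hX iltX Xv => m.
  by rewrite (h Z tZ) (table_label tC hX iltX Xv m k0 tZ).
apply: P11_and; first by apply: P11_record; ar.
apply: P11_allset; apply: P11_imp; first by apply: S11_arith; apply: (arith_table tC); ar.
apply: P11_arith; apply: arith_all; apply: arith_iff; first by ar.
by apply: (arith_label_code tC); ar.
Qed.

Context (B : set (set nat)) (pB : Pi11 x B) (BL : B `<=` labelled).
Context (Bex : forall v, labelled v -> exists u, B u /\ part 0 u = part 0 v).
Context (Buniq : forall u v, B u -> B v -> part 0 u = part 0 v -> u = v).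

(** As [c] varies, this countable family includes every label whose ordinals are ranks in the tree
    of [w]. *)
Definition word_meet (w : set nat) (c : nat) : set nat :=
  alive_meet child (word child w (decode c)).

(** Among the records with a given label only the one selected by [B] is kept. *)
Definition subtower (y : set nat) : Prop := record y /\ B (join (label y k) y).

Lemma Pi11_subtower : Pi11 x subtower.
Proof.
apply: Pi11_of_P11.
have hx : sdef (fun _ : set nat => [::]) (fun y => [:: y; x]) (fun _ => x).
  by exists (AMem (AVar 0) 1).
have hy : sdef (fun _ : set nat => [::]) (fun y => [:: y; x]) id.
  by exists (AMem (AVar 0) 0).
apply: (P11_eqv (Q := fun y => record y /\ forall d Z,
    table child y Z /\ (forall m, d m <-> label_code child k y Z m) -> B (join d y))).
  move=> y; rewrite /subtower; split=> -[ry h]; split=> //; have [[Xy _] _] := ry.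
    move=> d Z [tZ hd]; suff -> : d = label y k by [].
    by apply/funext => m; apply/propext; rewrite hd (table_label tC hX iltX Xy m k0 tZ).
  have [Z tZ] := table_ex tC hX iltX Xy; apply: (h _ Z); split=> // m.
  by rewrite (table_label tC hX iltX Xy m k0 tZ).
apply: P11_and; first by apply: P11_record.
apply: P11_allset; apply: P11_allset; apply: P11_imp; last by apply: (P11_of_Pi11 pB); ar.
apply: S11_arith; apply: arith_and; first by apply: (arith_table tC); ar.
apply: arith_all; apply: arith_iff; first by ar.
by apply: (arith_label_code tC); ar.
Qed.

Lemma subtower_sub : subtower `<=` X.
Proof. by move=> y [[[]]]. Qed.

(** If [y] has smaller data, [z] is a record above it in the data order. If neither precedes the
    other, their data and so their labels agree, and the uniqueness of [B] gives [y = z]. *)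
Lemma subtower_lexk y z : subtower y -> subtower z -> ~ lexk z y -> almost_subset z y.
Proof.
move=> Yy Yz nzy; have Xy := subtower_sub Yy; have Xz := subtower_sub Yz.
have [yz|nyz] := pselect (lexk y z).
  by have [[_ /(_ y Yy.1.1 yz)[]]] := Yz.
have e := eqlex_approx_of Xz Xy (lexk_total Xz Xy nzy nyz).
have [_ Bz] := Yz; have [_ By] := Yy; rewrite e in Bz.
have := Buniq Bz By; rewrite !part0_join => /(_ erefl)/(congr1 (part 1)).
by rewrite !part1_join => ->; apply: subset_almost.
Qed.

(** A record [y] is found whose label does not come from the tree of [w]. The selected record [y']
    with this label cannot have all its ranks in that tree, so [w] has smaller data than [y'], and
    the record [y'] is almost contained in [w]. *)
Lemma subtower_coinitial w : X w -> exists y, subtower y /\ almost_subset y w.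
Proof.
move=> /coinit[w' [Xkw' ww']].
suff [y [Yy yw']] : exists y, subtower y /\ almost_subset y w'.
  by exists y; split=> //; apply: almost_subset_trans ww'.
have {w ww'} Xw' := Xkw'.1; move: w' Xkw' Xw' => w Xkw Xw.
have [_ _ nX] := iltX.
pose D (c : nat) := word_meet w c.
(* No infinite [D c] is a pseudointersection of [X]; there are countably many, so one member [y0]
   lies below a refuting member for each. *)
have /choice[u hu] c : exists v, X v /\ (infinite_set (D c) -> ~ almost_subset (D c) v).
  have [iD|nD] := pselect (infinite_set (D c)); last by exists w; split=> // /nD.
  apply: contrapT => H; apply: nX; exists (D c); split=> // v Xv.
  by apply: contrapT => nv; apply: H; exists v.
have [n|y0 Xy0 y0u] := ilt_lower_bound iltX (u := u); first by have [] := hu n.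
pose M y := slice k y /\ forall c, infinite_set (D c) -> ~ almost_subset (D c) y.
have [||y [Xky nDy] ymin] := @slice_leftmost M; first by move=> v [[]].
- have [y1 [Xk1 y10]] := coinit Xy0; exists y1; split=> // c iD Dy1.
  apply: (hu c).2 iD _; apply: almost_subset_trans (y0u c).
  exact: almost_subset_trans Dy1 y10.
have Xy := Xky.1.
(* A member [z] of the slice with smaller data is not in [M], so it almost contains an infinite
   [D c] that [y] does not; by linearity [y] is strictly below [z]. *)
have ry : record y.
  split=> // z Xkz zy; have nMz : ~ M z by move=> /ymin.
  have [c iD Dz] : exists2 c, infinite_set (D c) & almost_subset (D c) z.
    apply: contrapT => H; apply: nMz; split=> // c iD Dz; apply: H; by exists c.
  have nzy : ~ almost_subset z y.
    by move=> /(almost_subset_trans Dz); apply: nDy.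
  by split=> //; apply: ilt_total iltX Xy Xkz.1 nzy.
have [|v [Bv ev]] := Bex (v := join (label y k) y).
  by rewrite /labelled part0_join part1_join.
have [rv hv] := BL Bv; rewrite part0_join in ev.
set y' := part 1 v in rv hv; have Xy' : X y' by case: rv => -[].
have edl : label y' k = label y k.
  by rewrite -ev; apply/funext => m; apply/propext; rewrite -hv.
have Yy' : subtower y' by split=> //; rewrite edl -ev join_part.
exists y'; split=> //.
have [wy'|nwy'] := pselect (lexk w y'); first by case: rv => _ /(_ w Xkw wy')[].
have le0 : rle child (y', 0) (w, 0).
  apply: contrapT => /(rle_total (wX 0 Xy')) lt; apply: nwy'.
  by exists 0; split=> //; split=> //; left.
(* Every rank in the tree of [y'] is at most that of its root, hence at most that of the root for
   [w], and so is attained in the tree of [w]. *)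
have [c ec] : exists c, approx_of child y' k = word child w (decode c).
  have /choice[f hf] i : exists n, rk child (y', i) = rk child (w, n).
    have [e|ne] := pselect (rk child (y', i) = rk child (w, 0)); first by exists 0.
    suff lt : rlt child (y', i) (w, 0).
      by apply: (lto_realized (p := (w, 0)) (wX 0 Xw)); apply/(lto_rk (wX i Xy') (wX 0 Xw)).
    case: i ne => [|i] ne; last first.
      apply: rlt_rle_trans le0; apply: step_rlt; split=> //=.
      by have [_ _ root] := tC; apply/root.
    apply: contrapT => nlt; apply: ne; apply/(rk_eq (wX 0 Xy') (wX 0 Xw)); split=> //.
    by apply: contrapT => /(rle_total (wX 0 Xw)).
  have [c e] := decode_surj (mkseq (fun i => 2 * f i + `[< y' i >]) k).
  exists c; rewrite e /word /mkseq -map_comp; apply: eq_map => i /=.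
  by rewrite /letter; congr (_, _); [lia|rewrite hf; congr (rk _ (_, _)); lia].
(* The common label of [y'] and [y] is an infinite subset of [y], against [y] being in [M]. *)
case: (nDy c); rewrite /D /word_meet -ec edl; first exact: (alive_meet_infinite tC hX iltX k0 Xky).
by apply: subset_almost; apply: (alive_meet_sub tC hX Xky).
Qed.

(** A lexicographically least element of a subset is its first element by [subtower_lexk], and by
    coinitiality a pseudointersection of the subtower would be one of [X]. *)
Lemma subtower_maximal : maximal_tower subtower.
Proof.
have [iX [_ anti tr _] nX] := iltX; split; last first.
  move=> [z [iz hz]]; apply: nX; exists z; split=> // w Xw.
  by have [y [Yy yw]] := subtower_coinitial Xw; apply: almost_subset_trans (hz y Yy) yw.
split; first by move=> y /subtower_sub/iX.
have least (M : set (set nat)) : M `<=` subtower -> M !=set0 ->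
    exists2 m, M m & forall b, M b -> almost_subset b m.
  move=> MY Mne; have [y My ymin] := @slice_leftmost M (fun y My => subtower_sub (MY y My)) Mne.
  by exists y => // b Mb; apply: subtower_lexk; [apply: MY|apply: MY|apply: ymin].
split=> //; split.
- by move=> u _; apply: subset_almost.
- move=> u v Yu Yv vu uv; exact: anti (subtower_sub Yu) (subtower_sub Yv) uv vu.
- by move=> u v w _ _ _ vu wv; apply: almost_subset_trans wv vu.
- move=> u v Yu Yv; have [_ [_ _ _ tot] _] := iltX.
  by case: (tot u v (subtower_sub Yu) (subtower_sub Yv)); [right|left].
Qed.

End Tower.

Theorem theorem7p1 (x : set nat) (X : set (set nat)) :
  Pi11 x X -> ilt X ->
  exists Y : set (set nat), [/\ Y `<=` X, Pi11 x Y & maximal_tower Y].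
Proof.
move=> pX iltX; have [child [tC hX]] := tree_repr pX.
have [k [k0 coinit]] := slice_coinitial iltX tC hX.
have [B [pB BL Bex Buniq]] := uniformization (Pi11_labelled pX iltX tC hX k0).
exists (subtower X child k B); split.
- exact: subtower_sub.
- exact: (Pi11_subtower pX iltX tC hX k0 pB).
- exact: (subtower_maximal iltX tC hX k0 coinit BL Bex Buniq).
Qed.
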